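(* Let $\mathcal{T}$ be a compact $3$-manifold triangulation built from $n$ tetrahedra. Suppose we are given the standard solution set for $\mathcal{T}$, and that it consists of the $k$ vectors $\mathbf{v}_1,\ldots,\mathbf{v}_k\in\mathbb{R}^{7n}$. Then the following algorithm computes the quadrilateral solution set for $\mathcal{T}$, and does so in $O(nk^2)$ time. 1. Compute the quadrilateral projections $\pi(\mathbf{v}_1),\ldots,\pi(\mathbf{v}_k)$. Throw away any zero vectors that result, and label the remaining non-zero vectors $\mathbf{q}_1,\ldots,\mathbf{q}_{k'}\in\mathbb{R}^{3n}$. 2. Begin with an empty list of vectors $L$. For each $i=1,\ldots,k'$, test whether the vector $\mathbf{q}_i$ dominates any other $\mathbf{q}_j$ with $j\neq i$. If not, insert the projective image $\overline{\mathbf{q}_i}$ into the list $L$. 3. Once step 2 is complete, the list $L$ holds the complete quadrilateral solution set for $\mathcal{T}$.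
   Context: Triangulations. A compact $3$-manifold triangulation $\mathcal{T}$ is a finite collection of tetrahedra $\Delta_1,\ldots,\Delta_n$, some or all of whose $4n$ faces are affinely identified in pairs, such that the resulting topological space is a compact $3$-manifold (possibly with boundary). Different vertices (or edges, or faces) of the same tetrahedron may be identified. Vertices, edges and faces of $\mathcal{T}$ are equivalence classes of tetrahedron vertices, edges and faces. A face not identified with another is a boundary face; boundary edges are those lying in the boundary. Normal discs. In each tetrahedron there are seven normal disc types: four triangle types (each surrounding one vertex of the tetrahedron) and three quadrilateral types (each separating one pair of opposite edges). Vectors in $\mathbb{R}^{7n}$ are written $(t_{1,1},t_{1,2},t_{1,3},t_{1,4},q_{1,1},q_{1,2},q_{1,3};\ \ldots,q_{n,3})$, where $t_{i,j}$ corresponds to the $j$th triangle type and $q_{i,k}$ to the $k$th quadrilateral type in $\Delta_i$. Vectors in $\mathbb{R}^{3n}$ are written $(q_{1,1},q_{1,2},q_{1,3};\ldots,q_{n,3})$. Standard matching equations (on $\mathbb{R}^{7n}$): for each non-boundary face $F$ and each edge $e$ of $F$, let $\Delta_i,\Delta_j$ be the two tetrahedra joined along $F$. In each there is exactly one triangle type and one quadrilateral type meeting $F$ in an arc parallel to $e$; if these have coordinates $t_{i,a},q_{i,b}$ and $t_{j,c},q_{j,d}$, the equation is $t_{i,a}+q_{i,b}=t_{j,c}+q_{j,d}$. Quadrilateral matching equations (on $\mathbb{R}^{3n}$): for each non-boundary edge $e$, the tetrahedra containing $e$ are arranged in a cycle $\Delta_{i_1},\ldots,\Delta_{i_k}$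 around $e$. Choose a direction around the cycle and label the ends of $e$ upper and lower. In each of these tetrahedra two quadrilateral types meet $e$: the upward one, rising from the lower end to the upper end as we move around the cycle (it cuts off the lower end of $e$ in the face through which we enter the tetrahedron and the upper end in the face through which we leave), and the downward one, falling in the opposite direction. With upward coordinates $q_{i_1,u_1},\ldots,q_{i_k,u_k}$ and downward coordinates $q_{i_1,d_1},\ldots,q_{i_k,d_k}$, the equation is $\sum_s q_{i_s,u_s}=\sum_s q_{i_s,d_s}$. Quadrilateral constraints (on $\mathbb{R}^{7n}$ or $\mathbb{R}^{3n}$): for each $i$, at most one of $q_{i,1},q_{i,2},q_{i,3}$ is non-zero. Solution sets. The standard projective solution space $\mathscr{S}(\mathcal{T})\subset\mathbb{R}^{7n}$ (resp. quadrilateral projective solution space $\mathscr{Q}(\mathcal{T})\subset\mathbb{R}^{3n}$) is the polytope of all vectors with non-negative coordinates summing to $1$ that satisfy the standard (resp. quadrilateral) matching equations. The standard (resp. quadrilateral) solution set is the finite set of all vertices of $\mathscr{S}(\mathcal{T})$ (resp. $\mathscr{Q}(\mathcal{T})$) that satisfy the quadrilateral constraints. Other notation. The quadrilateral projection $\pi:\mathbb{R}^{7n}\to\mathbb{R}^{3n}$ deletes all triangular coordinates. The projective image of $\mathbf{x}\ne\mathbf{0}$ is $\overline{\mathbf{x}}=\mathbf{x}/\sum x_i$, and $\overline{\mathbf{0}}=\mathbf{0}$. For $\mathbf{x},\mathbf{y}\in\mathbb{R}^d$, $\mathbf{x}$ dominates $\mathbf{y}$ if whenever $x_i=0$ we also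 have $y_i=0$. Running time counts each arithmetic operation or comparison on coordinates as constant time, so that operations on vectors take $O(n)$ time. *)

(* Defs.v *)
From Stdlib Require Import Relation_Operators.
From HB Require Import structures.
From mathcomp Require Import all_boot all_order all_algebra all_fingroup.
From mathcomp Require Import all_classical all_reals all_analysis.

Set Implicit Arguments.
Unset Strict Implicit.
Unset Printing Implicit Defensive.

Import Order.TTheory GRing.Theory Num.Theory numFieldNormedType.Exports.

Local Open Scope classical_set_scope.
Local Open Scope quotient_scope.
Local Open Scope ring_scope.

(** * Triangulations *)

(* The vertices of each tetrahedron are numbered by 'I_4, and face [f] is the
   face opposite vertex [f].  [glue T i f = Some (j, s)] means that face [f] of
   tetrahedron [i] is identified with face [s f] of tetrahedron [j], by the
   affine map sending vertex [v] to vertex [s v] for every [v != f];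
   [glue T i f = None] means that the face is a boundary face. *)
Record triangulation (n : nat) := Triangulation {
  glue : 'I_n -> 'I_4 -> option ('I_n * 'S_4);
  glue_sym : forall i f j (s : 'S_4),
    glue i f = Some (j, s) -> glue j (s f) = Some (i, (s^-1)%g);
  glue_neq : forall i f j (s : 'S_4),
    glue i f = Some (j, s) -> (j, s f) != (i, f) }.

(** * The underlying topological space *)

(* A tetrahedron, in barycentric coordinates. *)
Definition simplex3 (R : realType) : set 'rV[R]_4 :=
  [set x | (forall v, 0 <= x ord0 v) /\ \sum_v x ord0 v = 1].
Arguments simplex3 : clear implicits.

(* The disjoint union of n tetrahedra. *)
Definition tetrahedra (R : realType) (n : nat) : topologicalType :=
  {i : 'I_n & set_type (simplex3 R)}.

Section Realization.
Context (R : realType) (n : nat) (T : triangulation n).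

Definition bary (x : tetrahedra R n) : 'rV[R]_4 := set_val (projT2 x).

Definition glued (x y : tetrahedra R n) : Prop :=
  exists (f : 'I_4) (s : 'S_4),
    [/\ glue T (projT1 x) f = Some (projT1 y, s),
        bary x ord0 f = 0
      & forall v, bary y ord0 (s v) = bary x ord0 v].

Definition same_point (x y : tetrahedra R n) : bool :=
  `[< clos_refl_sym_trans _ glued x y >].

Lemma same_point_refl : reflexive same_point.
Proof. by move=> x; apply/asboolP; exact: rst_refl. Qed.

Lemma same_point_sym : symmetric same_point.
Proof.
by move=> x y; apply/idP/idP => /asboolP xy; apply/asboolP; exact: rst_sym.
Qed.

Lemma same_point_trans : transitive same_point.
Proof.
move=> y x z /asboolP xy /asboolP yz; apply/asboolP.
exact: (rst_trans _ _ _ _ _ xy yz).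
Qed.

Canonical same_point_equiv :=
  EquivRel same_point same_point_refl same_point_sym same_point_trans.

Definition realization : topologicalType :=
  quotient_topology {eq_quot same_point}.

End Realization.

Definition homeomorphic (X Y : topologicalType) : Prop :=
  exists (f : X -> Y) (g : Y -> X),
    [/\ continuous f, continuous g, cancel f g & cancel g f].

Definition second_countable_space (X : topologicalType) : Prop :=
  exists B : set (set X),
    [/\ countable B, B `<=` open
      & forall (x : X) (U : set X), open U -> U x ->
          exists V, [/\ B V, V x & V `<=` U]].

Definition half_space (R : realType) : set 'rV[R]_3 :=
  [set x | 0 <= x ord0 ord0].
Arguments half_space : clear implicits.

(* Boundary is allowed: interior points have charts with [W] inside the open
   half-space. *)
Definition compact_3manifold (R : realType) (M : topologicalType) : Prop :=
  [/\ compact [set: M], hausdorff_space M, second_countable_space M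
    & forall p : M, exists (U : set M) (W : set 'rV[R]_3),
        [/\ open U, U p, open W
          & homeomorphic (set_type U) (set_type (W `&` half_space R))]].

(** * Normal coordinates *)

(* R^{7n} is 'M[R]_(n, 4 + 3) and R^{3n} is 'M[R]_(n, 3): row i of a matrix
   holds (t_{i,1}, ..., t_{i,4}, q_{i,1}, q_{i,2}, q_{i,3}), respectively
   (q_{i,1}, q_{i,2}, q_{i,3}).  Triangle type v surrounds vertex v;
   quadrilateral type k separates the vertices 0 and k + 1 from the other
   two. *)
Definition with_vertex0 (k : 'I_3) (v : 'I_4) : bool :=
  (v == ord0) || (v == lift ord0 k).

Definition same_side (k : 'I_3) (a b : 'I_4) : bool :=
  with_vertex0 k a == with_vertex0 k b.

Section Coordinates.
Context (R : realType) (n : nat).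

Definition tri_coord (v : 'M[R]_(n, 4 + 3)) (i : 'I_n) (a : 'I_4) : R :=
  lsubmx v i a.

Definition quad_proj (v : 'M[R]_(n, 4 + 3)) : 'M[R]_(n, 3) := rsubmx v.

(* For a != b exactly one quadrilateral type has a and b on the same side, so
   that the sum has a single term. *)
Definition quad_coord (q : 'M[R]_(n, 3)) (i : 'I_n) (a b : 'I_4) : R :=
  \sum_(k | same_side k a b) q i k.

Definition coord_sum (m : nat) (x : 'M[R]_(n, m)) : R :=
  \sum_i \sum_j x i j.

(* The zero vector is its own projective image, as 0^-1 *: 0 = 0. *)
Definition proj_image (m : nat) (x : 'M[R]_(n, m)) : 'M[R]_(n, m) :=
  (coord_sum x)^-1 *: x.

Definition dominates (m : nat) (x y : 'M[R]_(n, m)) : Prop :=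
  forall i j, x i j = 0 -> y i j = 0.

Definition quad_constraints (q : 'M[R]_(n, 3)) : Prop :=
  forall i k l, q i k != 0 -> q i l != 0 -> k = l.

Definition nonneg_sum1 (m : nat) (x : 'M[R]_(n, m)) : Prop :=
  (forall i j, 0 <= x i j) /\ coord_sum x = 1.

End Coordinates.

(** * Matching equations *)

(* Inside face f, an arc parallel to an edge cuts off the vertex c of f not on
   that edge.  The quadrilateral meeting f in this arc separates c from the
   other two vertices of f, hence has c and f on the same side. *)
Definition standard_matching (R : realType) (n : nat) (T : triangulation n)
    (v : 'M[R]_(n, 4 + 3)) : Prop :=
  forall i f j (s : 'S_4) c, glue T i f = Some (j, s) -> c != f ->
    tri_coord v i c + quad_coord (quad_proj v) i f c =
    tri_coord v j (s c) + quad_coord (quad_proj v) j (s f) (s c).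

(* A step in a tour around an edge e: in the pair (i, p), tetrahedron i meets
   e in its edge from p 0 (lower end) to p 1 (upper end); the tour enters
   through face p 2 and leaves through face p 3. *)
Definition tour_state (n : nat) : Type := ('I_n * 'S_4)%type.

Definition tour_lower n (x : tour_state n) : 'I_4 := x.2 (inord 0).
Definition tour_upper n (x : tour_state n) : 'I_4 := x.2 (inord 1).
Definition tour_enter n (x : tour_state n) : 'I_4 := x.2 (inord 2).
Definition tour_leave n (x : tour_state n) : 'I_4 := x.2 (inord 3).

Definition tour_step n (T : triangulation n) : rel (tour_state n) :=
  fun x y =>
    if glue T x.1 (tour_leave x) is Some (j, s) then
      [&& y.1 == j, tour_lower y == s (tour_lower x),
          tour_upper y == s (tour_upper x) & tour_enter y == s (tour_leave x)]
    else false.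

(* The tour of a non-boundary edge closes up, whereas that of a boundary edge
   runs into a boundary face; so the duplicate-free cycles below are exactly
   the tours of the non-boundary edges, with all choices of starting point,
   direction and upper end (all giving the same equation up to sign), besides
   the empty cycle.  The upward quadrilateral cuts off the lower end in the
   face tour_enter, hence has tour_lower and tour_enter on the same side. *)
Definition quad_matching (R : realType) (n : nat) (T : triangulation n)
    (q : 'M[R]_(n, 3)) : Prop :=
  forall c : seq (tour_state n), ucycle (tour_step T) c ->
    \sum_(x <- c) quad_coord q x.1 (tour_lower x) (tour_enter x) =
    \sum_(x <- c) quad_coord q x.1 (tour_lower x) (tour_leave x).

(** * Solution sets *)

(* The vertices of a polytope, as its extreme points. *)
Definition vertices (R : realType) (V : lmodType R) (P : set V) : set V :=
  [set x | P x /\ forall (y z : V) (t : R), P y -> P z -> 0 < t < 1 ->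
             x = t *: y + (1 - t) *: z -> y = z].

Section SolutionSets.
Context (R : realType) (n : nat) (T : triangulation n).

Definition standard_solution_space : set 'M[R]_(n, 4 + 3) :=
  [set v | nonneg_sum1 v /\ standard_matching T v].

Definition quad_solution_space : set 'M[R]_(n, 3) :=
  [set q | nonneg_sum1 q /\ quad_matching T q].

Definition standard_solution_set : set 'M[R]_(n, 4 + 3) :=
  [set v | vertices standard_solution_space v /\
           quad_constraints (quad_proj v)].

Definition quad_solution_set : set 'M[R]_(n, 3) :=
  [set q | vertices quad_solution_space q /\ quad_constraints q].

End SolutionSets.

Definition enumerates (A : eqType) (s : seq A) (S : set A) : Prop :=
  uniq s /\ forall x, x \in s <-> S x.

(** * Computations with a step count *)

(* A computation is its result paired with its running time.  One unit is
   charged for each arithmetic operation or comparison on coordinates, for each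
   coordinate written into a new vector, and for each iteration of a loop.
   Reading a coordinate or a list entry and extending a list are part of the
   iteration in which they occur. *)
Definition timed (A : Type) : Type := (A * nat)%type.
Definition value A (m : timed A) : A := m.1.
Definition cost A (m : timed A) : nat := m.2.

Definition ret A (a : A) : timed A := (a, 0%N).
Definition charge1 A (m : timed A) : timed A := (value m, (cost m).+1).
Definition bind A B (m : timed A) (f : A -> timed B) : timed B :=
  (value (f (value m)), (cost m + cost (f (value m)))%N).

Notation "'let*' x := m 'in' k" := (bind m (fun x => k))
  (at level 200, x name, m at level 200, k at level 200).

Section Loops.
Context (A B : Type).

Fixpoint foldT (f : B -> A -> timed B) (b : B) (s : seq A) : timed B :=
  if s is a :: s' then let* b' := charge1 (f b a) in foldT f b' s' else ret b.

Fixpoint mapT (f : A -> timed B) (s : seq A) : timed (seq B) :=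
  if s is a :: s' then
    let* b := charge1 (f a) in let* t := mapT f s' in ret (b :: t)
  else ret [::].

Fixpoint filterT (p : A -> timed bool) (s : seq A) : timed (seq A) :=
  if s is a :: s' then
    let* b := charge1 (p a) in let* t := filterT p s' in
    ret (if b then a :: t else t)
  else ret [::].

Fixpoint hasT (p : A -> timed bool) (s : seq A) : timed bool :=
  if s is a :: s' then
    let* b := charge1 (p a) in if b then ret true else hasT p s'
  else ret false.

Fixpoint allT (p : A -> timed bool) (s : seq A) : timed bool :=
  if s is a :: s' then
    let* b := charge1 (p a) in if b then allT p s' else ret false
  else ret true.

End Loops.

Section VectorOperations.
Context (R : realType) (n : nat).

Definition addT (a b : R) : timed R := charge1 (ret (a + b)).
Definition divT (a b : R) : timed R := charge1 (ret (a / b)).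
Definition is0T (a : R) : timed bool := charge1 (ret (a == 0)).

Definition build_vectorT (m : nat) (F : 'I_n -> 'I_m -> timed R) :
    timed 'M[R]_(n, m) :=
  (\matrix_(i, j) value (F i j), (\sum_i \sum_j (cost (F i j)).+1)%N).

Definition quad_projT (v : 'M[R]_(n, 4 + 3)) : timed 'M[R]_(n, 3) :=
  build_vectorT (fun i k => ret (v i (rshift 4 k))).

Definition nonzeroT (m : nat) (x : 'M[R]_(n, m)) : timed bool :=
  let* z := allT (fun c => is0T (x c.1 c.2)) (enum {: 'I_n * 'I_m}) in
  ret (~~ z).

Definition dominatesT (m : nat) (x y : 'M[R]_(n, m)) : timed bool :=
  allT (fun c => let* z := is0T (x c.1 c.2) in
                 if z then is0T (y c.1 c.2) else ret true)
       (enum {: 'I_n * 'I_m}).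

Definition proj_imageT (m : nat) (x : 'M[R]_(n, m)) : timed 'M[R]_(n, m) :=
  let* s := foldT (fun a c => addT a (x c.1 c.2)) 0
                  (enum {: 'I_n * 'I_m}) in
  build_vectorT (fun i j => divT (x i j) s).

Lemma value_quad_projT v : value (quad_projT v) = quad_proj v.
Proof. by apply/matrixP => i j; rewrite !mxE. Qed.

Lemma value_allT (A : Type) (p : A -> timed bool) s :
  value (allT p s) = all (fun a => value (p a)) s.
Proof. by elim: s => //= a s <-; rewrite /bind /=; case: (value (p a)). Qed.

Lemma value_nonzeroT m (x : 'M[R]_(n, m)) : value (nonzeroT x) = (x != 0).
Proof.
rewrite /nonzeroT /= value_allT; congr (~~ _).
apply/allP/eqP => [x0|-> c _]; last by rewrite /= mxE.
apply/matrixP => i j; rewrite mxE; apply/eqP.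
by have := x0 (i, j); rewrite mem_enum; exact.
Qed.

Lemma value_dominatesT m (x y : 'M[R]_(n, m)) :
  value (dominatesT x y) <-> dominates x y.
Proof.
rewrite /dominatesT value_allT; split=> [/allP xy i j xij0|xy].
  have := xy (i, j); rewrite mem_enum => /(_ isT) /=.
  by rewrite xij0 eqxx => /eqP.
by apply/allP => -[i j] _ /=; case: eqP => //= /xy ->; exact: eqxx.
Qed.

Lemma value_proj_imageT m (x : 'M[R]_(n, m)) :
  value (proj_imageT x) = proj_image x.
Proof.
have foldE (s : seq ('I_n * 'I_m)) a :
    value (foldT (fun a c => addT a (x c.1 c.2)) a s) =
    a + \sum_(c <- s) x c.1 c.2.
  elim: s a => [|c s IHs] a /=; first by rewrite big_nil addr0.
  by rewrite big_cons addrA -IHs.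
apply/matrixP => i j; rewrite !mxE /= foldE add0r mulrC; congr (_^-1 * _).
by rewrite /coord_sum pair_big big_enum.
Qed.

(** * The conversion algorithm *)

Definition nonzero_projectionsT (vs : seq 'M[R]_(n, 4 + 3)) :
    timed (seq 'M[R]_(n, 3)) :=
  let* ps := mapT quad_projT vs in filterT (@nonzeroT 3) ps.

Definition dominates_anotherT (qs : seq 'M[R]_(n, 3)) (i : nat) : timed bool :=
  hasT (fun j => if j == i then ret false else dominatesT qs`_i qs`_j)
       (iota 0 (size qs)).

Definition standard_to_quadT (vs : seq 'M[R]_(n, 4 + 3)) :
    timed (seq 'M[R]_(n, 3)) :=
  let* qs := nonzero_projectionsT vs in
  foldT (fun L i =>
           let* d := dominates_anotherT qs i in
           if d then ret L
           else let* q := proj_imageT qs`_i in ret (rcons L q))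
        [::] (iota 0 (size qs)).

End VectorOperations.

(* Main.v *)
From Stdlib Require Import Relation_Operators.
From mathcomp Require Import all_boot all_order all_algebra all_fingroup.
From mathcomp Require Import all_classical all_reals all_analysis.
From mathcomp Require Import zify ring lra.
Require Import Defs.

Set Implicit Arguments.
Unset Strict Implicit.
Unset Printing Implicit Defensive.

Import Order.TTheory GRing.Theory Num.Theory numFieldNormedType.Exports.

Local Open Scope classical_set_scope.
Local Open Scope quotient_scope.
Local Open Scope ring_scope.

(** The projection deleting the triangle coordinates maps the cone of standard
solutions onto the cone of quadrilateral solutions, and a quadrilateral solution
has exactly one canonical preimage, namely one with a zero triangle coordinate
around every vertex of the triangulation.  Given this, the algorithm is linear
algebra on polytopes.  A point of a polytope cut out of the simplex by linear
equations is a vertex iff nothing else in the polytope has its zeros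
([vertices_support]).  A vertex of the standard polytope with non-zero projection
is canonical, since otherwise it would dominate a vertex link
([vertex_canonical]), so it is determined by the projective image of its
projection ([standard_proj_inj]).  The canonical preimage of a quadrilateral
vertex is, up to scale, a standard vertex ([quad_vertex_lift]).  Hence the
projections that dominate no other projection are, up to scale, exactly the
quadrilateral vertices, each met once ([minimal_proj_vertex], [vertex_proj_minimal]).

Surjectivity is where the manifold hypothesis enters.  Fix a quadrilateral vector
q.  The standard matching equations prescribe, for each glued face, the difference
of the triangle coordinates at the two corners that meet across it ([crossing]);
these differences form a 1-cochain on the dual graph of each vertex link, and the
quadrilateral matching equations say that it is closed around every interior
vertex of the link.  It must be shown to be exact, which follows from the link of
a vertex in a manifold being a sphere or a disc.  Rather than homology or
homotopy of the link, the proof uses locally constant families of local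
solutions.  Near every point of the open star of a vertex, the vertex excepted, the
equations at that point have a solution, unique up to a constant
([point_potential_crossing], [ex_local_section]).  The constants by which the
chosen solutions differ form a cocycle in the sense of [cocycle_on]
([transition_cocycle]).  Through a chart at a vertex this cocycle is carried to a
cubical shell, or half of one at a boundary vertex, and there every such cocycle
is a coboundary ([splits_shell]): on a convex compact set by subdivision
([splits_convex]), and on a union of two pieces with connected intersection by
matching one additive constant ([splitsU]).  Correcting the local solutions by
that coboundary yields a locally constant function on a small copy of the vertex
link; it is constant on each triangle of the link, and its values are the triangle
coordinates sought ([corner_potential]).

The running time is dominated by the k^2 domination tests, each linear in n
([cost_standard_to_quadT]). *)

(** * Locally constant functions and cocycles *)

(** A statement about intervals that holds for all short intervals around each
point, and is additive, holds for the whole segment: the supremum of the reachable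
endpoints can always be pushed further. *)
Lemma cousin (R : realType) (P : R -> R -> Prop) (a b : R) :
  a <= b ->
  (forall s t u, s <= t <= u -> P s t -> P t u -> P s u) ->
  (forall x, a <= x <= b -> exists2 e, 0 < e &
     forall s t, a <= s <= x -> x <= t <= b -> x - e < s -> t < x + e -> P s t) ->
  P a b.
Proof.
move=> ab Padd Ploc.
pose S := [set t | a <= t <= b /\ P a t].
have Sa : S a.
  have [|e e0 He] := Ploc a; first by rewrite lexx.
  split; first by rewrite lexx.
  by apply: He; rewrite ?lexx ?ab //; lra.
have Sub : ubound S b by move=> t [/andP[]].
have hS : has_sup S by split; [exists a|exists b].
set x := sup S.
have ax : a <= x by apply: ub_le_sup => //; exists b.
have xb : x <= b by apply: ge_sup => //; exists a.
have [|e e0 He] := Ploc x; first by rewrite ax xb.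
have [t [/andP[at_ tb] Pat] xet] := sup_adherent e0 hS.
have tx : t <= x by apply: ub_le_sup; [exists b|split=> //; rewrite at_ tb].
pose t' := Num.min b (x + e / 2).
have xt' : x <= t' by rewrite le_min xb /=; lra.
have t'b : t' <= b by rewrite ge_min lexx.
have t'e : t' < x + e.
  by apply: (@le_lt_trans _ _ (x + e / 2)); [rewrite ge_min lexx orbT|lra].
have Pt' : P a t'.
  apply: (Padd a t t') => //; first by rewrite at_ (le_trans tx xt').
  by apply: He; rewrite ?at_ ?tx ?xt' ?t'b.
have t'x : t' <= x.
  by apply: ub_le_sup; [exists b|split=> //; rewrite t'b (le_trans ax xt')].
have [bx|xe] := leP b (x + e / 2); last by move: t'x; rewrite /t' (min_idPr (ltW xe)); lra.
by move: Pt'; rewrite /t' (min_idPl bx).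
Qed.

Section Cocycles.
Context (R : realType) (Y : topologicalType).
Implicit Types (A B : set Y) (c : Y -> Y -> R).

Definition locally_constant_on (V : Type) A (g : Y -> V) :=
  forall y, A y -> \forall z \near y, A z -> g z = g y.

(** Connectedness in the only form in which it is used; the empty set qualifies, so
that disjoint pieces need no separate treatment when they are glued. *)
Definition lc_connected A :=
  forall g : Y -> R, locally_constant_on A g ->
  forall y z, A y -> A z -> g y = g z.

(** This is a Cech cocycle with constant coefficients, one chosen local
trivialization per point: [c y z] only matters for [z] close to [y], and then
compares the trivialization chosen at [z] with the one chosen at [y]. *)
Definition cocycle_on A c :=
  forall y, A y -> \forall z \near y, A z ->
    \forall w \near z, A w -> c y w = c y z + c z w.

(** The coboundary condition for [cocycle_on]: correcting by [h] makes the local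
trivializations agree. *)
Definition splits_on A c (h : Y -> R) :=
  forall y, A y -> \forall z \near y, A z -> h z = h y + c y z.

Definition splits A c := exists h, splits_on A c h.

Lemma lc_connectedU A B y :
  lc_connected A -> lc_connected B -> A y -> B y -> lc_connected (A `|` B).
Proof.
move=> cA cB Ay By g gAB.
have gA : locally_constant_on A g.
  move=> u Au; have := gAB u (or_introl Au).
  by apply: filterS => z gz Az; apply: gz; left.
have gB : locally_constant_on B g.
  move=> u Bu; have := gAB u (or_intror Bu).
  by apply: filterS => z gz Bz; apply: gz; right.
have gy z : (A `|` B) z -> g z = g y.
  by case=> [Az|Bz]; [apply: cA|apply: cB].
by move=> u v /gy -> /gy ->.
Qed.

Lemma splitsS A B c : A `<=` B -> splits B c -> splits A c.
Proof.
move=> AB [h hB]; exists h => y Ay.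
by have := hB y (AB _ Ay); apply: filterS => z hz Az; apply: hz; apply: AB.
Qed.

(** Near [y] the cocycle is the coboundary of [c y]. *)
Lemma splits_near A c y : A y -> cocycle_on A c ->
  exists2 U, nbhs y U & splits (A `&` U) c.
Proof.
move=> Ay cA; exists [set z | A z ->
    \forall w \near z, A w -> c y w = c y z + c z w]; first exact: cA.
exists (c y) => z [Az /(_ Az)]; apply: filterS => w cw [Aw _].
exact: cw.
Qed.

Lemma near_notin A y : closed A -> ~ A y -> \forall z \near y, ~ A z.
Proof.
move=> cA nA; have : open (~` A) by rewrite openC.
by move=> oA; have := open_nbhs_nbhs (conj oA nA).
Qed.

(** On the connected intersection the two given functions differ by a constant,
which can be subtracted from one of them; the simplest case of the Mayer-Vietoris
argument. *)
Lemma splitsU A B c : closed A -> closed B -> lc_connected (A `&` B) ->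
  splits A c -> splits B c -> splits (A `|` B) c.
Proof.
move=> clA clB cAB [h hA] [k kB].
pose g z := h z - k z.
have gAB : locally_constant_on (A `&` B) g.
  move=> y [Ay By]; have := hA y Ay; have := kB y By.
  apply: filterS2 => z kz hz [Az Bz].
  by rewrite /g (kz Bz) (hz Az); lra.
have [d gd] : exists d, forall z, (A `&` B) z -> g z = d.
  have [[y ABy]|nAB] := pselect (exists y, (A `&` B) y).
    by exists (g y) => z ABz; exact: cAB.
  by exists 0 => z ABz; case: nAB; exists z.
pose l z := if `[< A z >] then h z else k z + d.
have lA z : A z -> l z = h z by move=> Az; rewrite /l asboolT.
have lB z : B z -> l z = k z + d.
  move=> Bz; rewrite /l; case: asboolP => // Az.
  by rewrite -(gd z) // /g; lra.
exists l => y ABy.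
have lAy : \forall z \near y, A z -> l z = l y + c y z.
  have [Ay|nAy] := pselect (A y).
    have := hA y Ay; apply: filterS => z hz Az.
    by rewrite !lA // hz.
  by have := near_notin clA nAy; apply: filterS.
have lBy : \forall z \near y, B z -> l z = l y + c y z.
  have [By|nBy] := pselect (B y).
    have := kB y By; apply: filterS => z kz Bz.
    by rewrite !lB // kz //; lra.
  by have := near_notin clB nBy; apply: filterS.
by near=> z => -[Az|Bz]; [apply: (near lAy)|apply: (near lBy)].
Unshelve. all: by end_near. Qed.

(** Connectedness of the segment, obtained from [cousin] applied to the relation of
having equal values at the two ends of an interval. *)
Lemma lc_path A (g : Y -> R) (p : R -> Y) : continuous p ->
  (forall t, 0 <= t <= 1 -> A (p t)) -> locally_constant_on A g ->
  g (p 0) = g (p 1).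
Proof.
move=> cp Ap gA.
apply: (@cousin R (fun s t => g (p s) = g (p t))) => //.
  by move=> s t u _ -> ->.
move=> x x01; have := cp x _ (gA _ (Ap _ x01)).
move=> /nbhs_ballP [e /= e0 He]; exists e => // s t /andP[s0 sx] /andP[xt t1] xs tx.
rewrite (He s) ?(He t) //=; try (apply: Ap; move/andP: x01 => [? ?]; lra).
- by rewrite /ball /= ltr_norml; apply/andP; split; lra.
- by rewrite /ball /= ltr_norml; apply/andP; split; lra.
Qed.

End Cocycles.

Section Convex.
Context (R : realType) (m : nat).
Implicit Types (A D : set 'rV[R]_m) (c : 'rV[R]_m -> 'rV[R]_m -> R).

Definition segment_closed A := forall y z t, A y -> A z -> 0 <= t <= 1 ->
  A (y + t *: (z - y)).

Lemma segment_closedI A D : segment_closed A -> segment_closed D ->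
  segment_closed (A `&` D).
Proof. by move=> cA cD y z t [? ?] [? ?] t01; split; [apply: cA|apply: cD]. Qed.

Lemma lc_connected_convex A : segment_closed A -> lc_connected R A.
Proof.
move=> convA g gA y z Ay Az.
have := @lc_path R _ A g (fun t => y + t *: (z - y)) _ _ gA.
rewrite /= scale0r addr0 scale1r subrKC; apply.
  move=> t; apply: cvgD; first exact: cvg_cst.
  by apply: cvgZr_tmp; exact: cvg_id.
by move=> t t01; exact: convA.
Qed.

Definition slab i (s t : R) : set 'rV[R]_m := [set z | s <= z ord0 i <= t].

Lemma slab_closed i s t : closed (slab i s t).
Proof.
have -> : slab i s t = (fun z : 'rV[R]_m => z ord0 i) @^-1` `[s, t]%classic.
  by apply/seteqP; split => z; rewrite /slab /= in_itv.
apply: closed_comp => [z _|]; first exact: coord_continuous.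
exact: itv_closed.
Qed.

Lemma slab_convex i s t : segment_closed (slab i s t).
Proof.
move=> y z r; rewrite /slab /= !mxE => /andP[y1 y2] /andP[z1 z2] /andP[r0 r1].
by apply/andP; split; nra.
Qed.

Lemma coord_near (z : 'rV[R]_m) (e : R) : 0 < e ->
  nbhs z [set w : 'rV[R]_m | forall i, `|w ord0 i - z ord0 i| < e].
Proof.
move=> e0; apply/nbhs_ballP; exists e => //= w zw i.
by case: zw => _ /(_ ord0 i); rewrite /ball /= distrC.
Qed.

Lemma near_coord (z : 'rV[R]_m) (U : set 'rV[R]_m) : nbhs z U ->
  exists2 e : R, 0 < e & forall w : 'rV[R]_m, (forall i, `|w ord0 i - z ord0 i| < e) -> U w.
Proof.
move=> /nbhs_ballP[e /= e0 He]; exists e => // w Hw; apply: He; split=> // i j.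
by rewrite (ord1 i) /ball /= distrC.
Qed.

(** The sets [thin k x e] restrict the coordinates from [k] on to the [e]-neighbourhood
of those of [x].  Induction on [k] releases one coordinate at a time: for each value
of the new coordinate the induction hypothesis gives a width [e], and [cousin]
combines these into a single width for all values, gluing along convex slices. *)
Lemma splits_convex D c (M : R) : 0 <= M -> closed D -> segment_closed D ->
  (forall z i, D z -> - M <= z ord0 i <= M) -> cocycle_on D c -> splits D c.
Proof.
move=> M0 clD convD bD cD.
  pose thin k (x : 'rV[R]_m) e :=
    D `&` [set z | forall i : 'I_m, (k <= i)%N -> `|z ord0 i - x ord0 i| <= e].
  suff H : forall k, (k <= m)%N -> forall x, exists2 e, 0 < e & splits (thin k x e) c.
    have [e e0] := H m (leqnn m) 0; apply: splitsS => z Dz; split=> // i.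
    by rewrite leqNgt ltn_ord.
  have thinS k x e e' : e' <= e -> thin k x e' `<=` thin k x e.
    by move=> e'e z [Dz Hz]; split=> // i ki; apply: le_trans (Hz i ki) e'e.
  elim=> [|k IHk] km x.
    have [Dx|nDx] := pselect (D x).
      have [U Ux sU] := splits_near Dx cD.
      have [e e0 He] := near_coord Ux; exists (e / 2); first by lra.
      apply: splitsS sU => z [Dz Hz]; split=> //; apply: He => i.
      by apply: le_lt_trans (Hz i isT) _; lra.
    have [e e0 He] := near_coord (near_notin clD nDx).
    exists (e / 2); first by lra.
    exists 0 => z [Dz Hz]; case: (He z) => // i.
    by apply: le_lt_trans (Hz i isT) _; lra.
  pose i0 := Ordinal km.
  suff : exists2 e, 0 < e & splits (thin k.+1 x e `&` slab i0 (- M) M) c.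
    case=> e e0 se; exists e => //; apply: splitsS se => z [Dz Hz].
    by do 2?split=> //; exact: bD.
  apply: (@cousin R (fun s t =>
    exists2 e, 0 < e & splits (thin k.+1 x e `&` slab i0 s t) c)); first by lra.
    move=> s t u /andP[st tu] [e e0 se] [e' e'0 se'].
    exists (Num.min e e'); first by rewrite lt_min e0 e'0.
    set E := thin _ _ _.
    have cE : closed E.
      have -> : E = D `&` \bigcap_(i in [set i : 'I_m | (k < i)%N])
          slab i (x ord0 i - Num.min e e') (x ord0 i + Num.min e e').
        by apply/seteqP; split=> z [Dz Hz]; split=> // i ki; have := Hz i ki;
          rewrite /slab /= ler_distl.
      by apply: closedI => //; apply: closed_bigI => i _; exact: slab_closed.
    have convE : segment_closed E.
      move=> y z r [Dy Hy] [Dz Hz] r01; split; first exact: convD.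
      move=> i ki; have := Hy i ki; have := Hz i ki.
      rewrite !ler_distl !mxE => /andP[? ?] /andP[? ?].
      by move: r01 => /andP[? ?]; apply/andP; split; nra.
    have EE : E `&` slab i0 s u = (E `&` slab i0 s t) `|` (E `&` slab i0 t u).
      apply/seteqP; split=> [z [Ez]|z [[Ez]|[Ez]]]; rewrite /slab /= => /andP[z1 z2].
      - have [zt|zt] := leP (z ord0 i0) t; [left|right]; split=> //=.
          by rewrite z1.
        by rewrite z2 ltW.
      - by split=> //; rewrite /slab /=; lra.
      - by split=> //; rewrite /slab /=; lra.
    rewrite EE; apply: splitsU.
    - by apply: closedI => //; exact: slab_closed.
    - by apply: closedI => //; exact: slab_closed.
    - apply: lc_connected_convex; apply: segment_closedI;
        by apply: segment_closedI => //; exact: slab_convex.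
    - apply: splitsS se => z [Ez Hz]; split=> //; apply: thinS Ez.
      by rewrite ge_min lexx.
    - apply: splitsS se' => z [Ez Hz]; split=> //; apply: thinS Ez.
      by rewrite ge_min lexx orbT.
  move=> t _.
  pose x' := \row_j (if j == i0 then t else x ord0 j).
  have [e e0 se] := IHk (ltnW km) x'.
  exists e => // s u /andP[_ st] /andP[tu _] se1 ue1.
  exists e => //; apply: splitsS se => z [[Dz Hz] /andP[z1 z2]]; split=> // i ki.
  rewrite mxE; case: eqP => [->|ne]; first by rewrite ler_distl; lra.
  apply: Hz; rewrite ltn_neqAle ki andbT; apply/eqP => ki'.
  by apply: ne; apply: val_inj.
Qed.

End Convex.

(** * Cubical shells *)

Lemma cocycle_onS (R : realType) (Y : topologicalType) (A B : set Y)
    (c : Y -> Y -> R) : A `<=` B -> cocycle_on B c -> cocycle_on A c.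
Proof.
move=> AB cB y Ay; have := cB y (AB _ Ay); apply: filterS => z cz Az.
by have := cz (AB _ Az); apply: filterS => w cw Aw; apply: cw; apply: AB.
Qed.

(** Cocycles and coboundaries pull back along a map that is continuous within the
set considered; this transports them through charts and translations. *)
Section Pullback.
Context (R : realType) (X Y : topologicalType) (f : X -> Y).
Context (A : set X) (B : set Y) (c : Y -> Y -> R).
Hypothesis fAB : forall x, A x -> B (f x).
Hypothesis f_cont : forall x, A x -> forall U, nbhs (f x) U ->
  \forall z \near x, A z -> U (f z).

Lemma cocycle_pullback : cocycle_on B c ->
  cocycle_on A (fun x y => c (f x) (f y)).
Proof.
move=> cB x Ax; have := f_cont Ax (cB _ (fAB Ax)).
apply: filterS => z fz Az; have := f_cont Az (fz Az (fAB Az)).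
by apply: filterS => w fw Aw; apply: fw => //; exact: fAB.
Qed.

Lemma splits_pullback : splits B c -> splits A (fun x y => c (f x) (f y)).
Proof.
move=> [h hB]; exists (h \o f) => x Ax; have := f_cont Ax (hB _ (fAB Ax)).
by apply: filterS => z fz Az; apply: fz => //; exact: fAB.
Qed.

End Pullback.

Section Shell.
Context (R : realType).
Implicit Types (c : 'rV[R]_3 -> 'rV[R]_3 -> R).

Let i0 : 'I_3 := ord0.
Let i1 : 'I_3 := @Ordinal 3 1 isT.
Let i2 : 'I_3 := @Ordinal 3 2 isT.

Definition box (a0 b0 a1 b1 a2 b2 : R) : set 'rV[R]_3 :=
  slab i0 a0 b0 `&` (slab i1 a1 b1 `&` slab i2 a2 b2).

Lemma box_closed a0 b0 a1 b1 a2 b2 : closed (box a0 b0 a1 b1 a2 b2).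
Proof. by do 2?[apply: closedI]; exact: slab_closed. Qed.

Lemma box_convex a0 b0 a1 b1 a2 b2 : segment_closed (box a0 b0 a1 b1 a2 b2).
Proof. by do 2?[apply: segment_closedI]; exact: slab_convex. Qed.

Lemma boxI_connected a0 b0 a1 b1 a2 b2 a0' b0' a1' b1' a2' b2' :
  lc_connected R (box a0 b0 a1 b1 a2 b2 `&` box a0' b0' a1' b1' a2' b2').
Proof.
by apply: lc_connected_convex; apply: segment_closedI; exact: box_convex.
Qed.

Definition point3 (x y z : R) : 'rV[R]_3 := \row_j [:: x; y; z]`_j.

Lemma box_point (a0 b0 a1 b1 a2 b2 x y z : R) :
  a0 <= x <= b0 -> a1 <= y <= b1 -> a2 <= z <= b2 ->
  box a0 b0 a1 b1 a2 b2 (point3 x y z).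
Proof. by move=> hx hy hz; rewrite /box /slab /= !mxE. Qed.

Context (d r : R).

Lemma splits_box c (a0 b0 a1 b1 a2 b2 : R) :
  0 <= r -> - r <= a0 -> b0 <= r -> - r <= a1 -> b1 <= r -> - r <= a2 -> b2 <= r ->
  cocycle_on (box a0 b0 a1 b1 a2 b2) c -> splits (box a0 b0 a1 b1 a2 b2) c.
Proof.
move=> r0 ha0 hb0 ha1 hb1 ha2 hb2; apply: (@splits_convex _ _ _ _ r); first by [].
- exact: box_closed.
- exact: box_convex.
move=> z i [h0 [h1 h2]]; move: h0 h1 h2; rewrite /slab /=.
move=> /andP[? ?] /andP[? ?] /andP[? ?].
have [->|->|->] : [\/ i = i0, i = i1 | i = i2].
- by case: i => -[|[|[|//]]] Hi; [constructor 1|constructor 2|constructor 3];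
    apply: val_inj.
all: by apply/andP; split; lra.
Qed.

(* Pieces of the shell between the cubes of half-side d and r.  T1 and T2 lie at
   distance at least d from the centre in coordinate 0, S1 and S2 in coordinate 1, S3
   and S4 in coordinate 2; m is the lower bound on coordinate 0 for the last four, 0
   for half a shell and -d for a whole one. *)
Let T1 := box d r (- r) r (- r) r.
Let T2 := box (- r) (- d) (- r) r (- r) r.
Let S1 m := box m d d r (- r) r.
Let S2 m := box m d (- r) (- d) (- r) r.
Let S3 m := box m d (- d) d d r.
Let S4 m := box m d (- d) d (- r) (- d).

Definition half_shell m := T1 `|` S1 m `|` S2 m `|` S3 m `|` S4 m.

Lemma disjoint_boxes (i : 'I_3) (A B : set 'rV[R]_3) (s t : R) :
  s < t -> A `<=` slab i (- r) s -> B `<=` slab i t r -> A `&` B = set0.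
Proof.
move=> st AS BT; apply/seteqP; split=> // z [/AS + /BT].
by rewrite /slab /= => /andP[_ ?] /andP[? _]; lra.
Qed.

(** The pieces are glued one at a time, in an order in which each new box meets the
union of the previous ones in a connected set. *)
Lemma splits_half_shell c (m : R) : 0 < d -> d < r -> - d <= m -> m <= 0 ->
  cocycle_on (half_shell m) c -> splits (half_shell m) c.
Proof.
move=> d0 dr dm m0 cc.
have bb := boxI_connected.
have cl := box_closed.
have [cT1 cS1 cS2 cS3 cS4] : [/\ cocycle_on T1 c, cocycle_on (S1 m) c,
    cocycle_on (S2 m) c, cocycle_on (S3 m) c & cocycle_on (S4 m) c].
  by split; apply: cocycle_onS cc => z Hz; rewrite /half_shell /=; tauto.
have [sT1 sS1 sS2 sS3 sS4] : [/\ splits T1 c, splits (S1 m) c,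
    splits (S2 m) c, splits (S3 m) c & splits (S4 m) c].
  by split; rewrite /T1 /S1 /S2 /S3 /S4; apply: splits_box => //; lra.
have S12 : S1 m `&` S2 m = set0.
  rewrite setIC; apply: (@disjoint_boxes i1 _ _ (- d) d) => [|z|z]; first by lra.
    by case=> _ [].
  by case=> _ [].
have S34 : S3 m `&` S4 m = set0.
  rewrite setIC; apply: (@disjoint_boxes i2 _ _ (- d) d) => [|z|z]; first by lra.
    by case=> _ [].
  by case=> _ [].
rewrite /half_shell; apply: splitsU; [by do ?[apply: closedU]; exact: cl| exact: cl| | |];
  last 2 first.
- apply: splitsU; [by do ?[apply: closedU]; exact: cl| exact: cl| | |];
  last 2 first.
  + apply: splitsU; [by do ?[apply: closedU]; exact: cl| exact: cl| | |];
  last 2 first.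
    * by apply: splitsU => //; [exact: cl|exact: cl|exact: bb].
    * by [].
    by rewrite setIUl S12 setU0; exact: bb.
  + by [].
  rewrite !setIUl; apply: (@lc_connectedU _ _ _ _ (point3 d (- d) d)); [ |exact: bb| |].
  + apply: (@lc_connectedU _ _ _ _ (point3 d d d)); [exact: bb|exact: bb| |];
      by split; apply: box_point; lra.
  + by left; split; apply: box_point; lra.
  + by split; apply: box_point; lra.
- by [].
rewrite !setIUl S34 setU0; apply: (@lc_connectedU _ _ _ _ (point3 d (- d) (- d))); [ |exact: bb| |].
- apply: (@lc_connectedU _ _ _ _ (point3 d d (- d))); [exact: bb|exact: bb| |];
    by split; apply: box_point; lra.
- by left; split; apply: box_point; lra.
- by split; apply: box_point; lra.
Qed.

(** The slab left over meets the others in a square annulus, made of four strips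
joined at the corners. *)
Lemma splits_full_shell c : 0 < d -> d < r ->
  cocycle_on (half_shell (- d) `|` T2) c ->
  splits (half_shell (- d) `|` T2) c.
Proof.
move=> d0 dr cc; have bb := boxI_connected; have cl := box_closed.
have T12 : T1 `&` T2 = set0.
  rewrite setIC; apply: (@disjoint_boxes i0 _ _ (- d) d) => [|z|z]; first by lra.
    by case.
  by case.
apply: splitsU.
- by rewrite /half_shell; do ?[apply: closedU]; exact: cl.
- exact: cl.
- rewrite !setIUl T12 set0U [_ `|` _ `|` (S3 _ `&` _)]setUAC.
  apply: (@lc_connectedU _ _ _ _ (point3 (- d) (- d) (- d))); [ |exact: bb| |].
  + apply: (@lc_connectedU _ _ _ _ (point3 (- d) (- d) d)); [ |exact: bb| |].
    * apply: (@lc_connectedU _ _ _ _ (point3 (- d) d d)); [exact: bb|exact: bb| |];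
        by split; apply: box_point; lra.
    * by right; split; apply: box_point; lra.
    * by split; apply: box_point; lra.
  + by right; split; apply: box_point; lra.
  + by split; apply: box_point; lra.
- apply: splits_half_shell; [by []|by []|by []|lra|].
  by apply: cocycle_onS cc => z; left.
- rewrite /T2; apply: splits_box; try lra.
  by apply: cocycle_onS cc => z; right.
Qed.
(** With [b] on the boundary of the half-space or at distance at least [r] from it,
this is half a cubical shell or a whole one. *)
Definition shell (b : 'rV[R]_3) : set 'rV[R]_3 :=
  [set z | [/\ 0 <= z ord0 ord0, forall i, `|z ord0 i - b ord0 i| <= r
     & exists i, d <= `|z ord0 i - b ord0 i|]].

Lemma ord3P (P : 'I_3 -> Prop) : P i0 -> P i1 -> P i2 -> forall i, P i.
Proof.
move=> H0 H1 H2 [[|[|[|//]]] Hi].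
- by have -> : Ordinal Hi = i0 by exact: val_inj.
- by have -> : Ordinal Hi = i1 by exact: val_inj.
- by have -> : Ordinal Hi = i2 by exact: val_inj.
Qed.

Lemma centred_shellE (b : 'rV[R]_3) u : shell b (u + b) <->
  [/\ 0 <= u ord0 i0 + b ord0 i0,
      [/\ - r <= u ord0 i0 <= r, - r <= u ord0 i1 <= r & - r <= u ord0 i2 <= r]
    & [\/ u ord0 i0 <= - d \/ d <= u ord0 i0, u ord0 i1 <= - d \/ d <= u ord0 i1
      | u ord0 i2 <= - d \/ d <= u ord0 i2]].
Proof.
have E i : (u + b) ord0 i - b ord0 i = u ord0 i by rewrite mxE addrK.
have N x : d <= `|x| <-> x <= - d \/ d <= x.
  rewrite ler_normr; split=> [/orP[] H|[] H].
  - by right.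
  - by left; lra.
  - by apply/orP; right; lra.
  - by apply/orP; left.
split=> [[h0 hr [i hi]]|[h0 [hr0 hr1 hr2] hi]].
  split; first by move: h0; rewrite mxE.
    by split; rewrite -E -ler_norml.
  move: hi; rewrite E N; move: i; apply: ord3P => hi;
  by [constructor 1|constructor 2|constructor 3].
split; first by rewrite mxE.
  by apply: ord3P; rewrite E ler_norml.
by case: hi => hi; [exists i0|exists i1|exists i2]; rewrite E N.
Qed.

Lemma half_shellE u : 0 < d -> d < r -> half_shell 0 u <->
  [/\ 0 <= u ord0 i0,
      [/\ - r <= u ord0 i0 <= r, - r <= u ord0 i1 <= r & - r <= u ord0 i2 <= r]
    & [\/ u ord0 i0 <= - d \/ d <= u ord0 i0, u ord0 i1 <= - d \/ d <= u ord0 i1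
      | u ord0 i2 <= - d \/ d <= u ord0 i2]].
Proof.
move=> d0 dr; rewrite /half_shell /T1 /S1 /S2 /S3 /S4 /box /slab /=.
set x := u _ i0; set y := u _ i1; set z := u _ i2.
split.
  move=> [[[[]|]|]|] [/andP[? ?] [/andP[? ?] /andP[? ?]]].
  - by split; [lra|split; lra|constructor 1; right].
  - by split; [lra|split; lra|constructor 2; right].
  - by split; [lra|split; lra|constructor 2; left].
  - by split; [lra|split; lra|constructor 3; right].
  - by split; [lra|split; lra|constructor 3; left].
move=> [? [/andP[? ?] /andP[? ?] /andP[? ?]] H].
have [?|?] := lerP d x; first by do 4 left; split; [|split]; lra.
have [?|?] := lerP d y; first by do 3 left; right; split; [|split]; lra.
have [?|?] := lerP y (- d); first by do 2 left; right; split; [|split]; lra.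
have [?|?] := lerP d z; first by left; right; split; [|split]; lra.
by right; case: H => -[] ?; (split; [|split]); lra.
Qed.

Lemma full_shellE u : 0 < d -> d < r -> (half_shell (- d) `|` T2) u <->
  [/\ - r <= u ord0 i0 <= r, - r <= u ord0 i1 <= r & - r <= u ord0 i2 <= r] /\
  [\/ u ord0 i0 <= - d \/ d <= u ord0 i0, u ord0 i1 <= - d \/ d <= u ord0 i1
      | u ord0 i2 <= - d \/ d <= u ord0 i2].
Proof.
move=> d0 dr; rewrite /half_shell /T1 /T2 /S1 /S2 /S3 /S4 /box /slab /=.
set x := u _ i0; set y := u _ i1; set z := u _ i2.
split.
  move=> [[[[[]|]|]|]|] [/andP[? ?] [/andP[? ?] /andP[? ?]]].
  - by split; [split; lra|constructor 1; right].
  - by split; [split; lra|constructor 2; right].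
  - by split; [split; lra|constructor 2; left].
  - by split; [split; lra|constructor 3; right].
  - by split; [split; lra|constructor 3; left].
  - by split; [split; lra|constructor 1; left].
move=> [[/andP[? ?] /andP[? ?] /andP[? ?]] H].
have [?|?] := lerP x (- d); first by right; split; [|split]; lra.
left; have [?|?] := lerP d x; first by do 4 left; split; [|split]; lra.
have [?|?] := lerP d y; first by do 3 left; right; split; [|split]; lra.
have [?|?] := lerP y (- d); first by do 2 left; right; split; [|split]; lra.
have [?|?] := lerP d z; first by left; right; split; [|split]; lra.
by right; case: H => -[] ?; (split; [|split]); lra.
Qed.

Lemma splits_shell (b : 'rV[R]_3) c : 0 < d -> d < r ->
  b ord0 ord0 = 0 \/ r <= b ord0 ord0 ->
  cocycle_on (shell b) c -> splits (shell b) c.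
Proof.
move=> d0 dr hb cc.
have shift_cont (v u : 'rV[R]_3) U : nbhs (u + v) U ->
    \forall z \near u, U (z + v).
  move=> /near_coord[e e0 He]; apply: filterS (coord_near u e0) => z Hz.
  by apply: He => i; rewrite !mxE opprD addrACA subrr addr0.
pose S' := [set u | shell b (u + b)].
have c' : cocycle_on S' (fun u v => c (u + b) (v + b)).
  apply: (@cocycle_pullback R 'rV[R]_3 'rV[R]_3 (fun u => u + b) S' (shell b) c) => //.
  move=> u _ U /shift_cont.
  by apply: filterS.
have : splits S' (fun u v => c (u + b) (v + b)).
  case: hb => hb.
    have S'E : S' = half_shell 0.
      apply/seteqP; split=> u; rewrite /S' /= centred_shellE half_shellE // hb addr0 //.
    rewrite S'E in c' *.
    by apply: splits_half_shell => //; lra.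
  have S'E : S' = half_shell (- d) `|` T2.
    apply/seteqP; split=> u; rewrite full_shellE // /S' /= centred_shellE; first by case.
    by move=> [[H1 H2 H3] H4]; split=> //; move/andP: H1 => [? ?]; lra.
  rewrite S'E in c' *.
  exact: splits_full_shell.
move=> s'.
have -> : c = fun u v => c (u - b + b) (v - b + b).
  by apply/funext => u; apply/funext => v; rewrite !subrK.
apply: (@splits_pullback R 'rV[R]_3 'rV[R]_3 (fun u => u - b) (shell b) S'
  (fun u v => c (u + b) (v + b))) => //.
  by move=> u; rewrite /S' /= subrK.
move=> u _ U /shift_cont.
by apply: filterS.
Qed.

End Shell.

(** * Tours around edges *)

Local Notation orbit := fingraph.orbit.

Section Potential.
Context (R : realFieldType) (S : finType) (tau : S -> S) (b : S -> R).
Hypothesis tau_inj : injective tau.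
Hypothesis b_sum : forall x, \sum_(y <- orbit tau x) b y = 0.

Let N x := fingraph.order tau x.

(** The average, over the starting points on the orbit of [x], of the sum of [b]
along the orbit from there to [x].  Averaging avoids choosing a base point in each
orbit. *)
Definition potential (x : S) : R :=
  - ((N x)%:R)^-1 * \sum_(0 <= j < N x) \sum_(0 <= l < j) b (iter l tau x).

Lemma sum_over_orbit x : \sum_(0 <= j < N x) b (iter j tau x) = 0.
Proof.
rewrite -[RHS](b_sum x) [RHS](big_nth x) size_traject -/(N x).
by apply: eq_big_nat => j /andP[_ jN]; rewrite nth_traject.
Qed.

Lemma potentialE x : potential (tau x) = potential x + b x.
Proof.
have NE : N (tau x) = N x by apply: order_id_cycle; exact: cycle_orbit.
have N0 : (N x)%:R != 0 :> R by rewrite pnatr_eq0 -lt0n; exact: fingraph.order_gt0.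
rewrite /potential NE; apply/eqP; rewrite -subr_eq0 opprD addrA -mulrBr -sumrB.
have -> : \sum_(0 <= j < N x) (\sum_(0 <= l < j) b (iter l tau (tau x)) -
    \sum_(0 <= l < j) b (iter l tau x)) = \sum_(0 <= j < N x) (b (iter j tau x) - b x).
  apply: eq_bigr => j _; rewrite -sumrB.
  have /= <- := telescope_sumr (fun l => b (iter l tau x)) (leq0n j).
  by apply: eq_bigr => l _; rewrite -iterSr.
rewrite sumrB sum_over_orbit sumr_const_nat subn0 sub0r mulrNN.
by rewrite -[b x *+ _]mulr_natl mulKf // subrr.
Qed.

End Potential.

Section States.
Context (R : realType) (n : nat) (T : triangulation n) (q : 'M[R]_(n, 3)).
Implicit Types (u : tour_state n).

Let flip : 'S_4 := tperm (inord 2) (inord 3).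

(** The increase of the triangle coordinate at corner [c] of tetrahedron [i] that the
standard matching equation prescribes on passing through face [f].  The value 0 on
boundary faces is what makes [tour_cost] vanish where a tour bounces back. *)
Definition crossing (i : 'I_n) (f c : 'I_4) : R :=
  if glue T i f is Some (j, s) then
    quad_coord q i f c - quad_coord q j (s f) (s c)
  else 0.

Definition tour_cost u := crossing u.1 (tour_leave u) (tour_lower u).

Definition tour_reverse u : tour_state n := (u.1, (flip * u.2)%g).

(** At a boundary face the tour turns round.  This makes the step a permutation of
the states, so that interior and boundary edges are treated alike. *)
Definition tour_next u : tour_state n :=
  if glue T u.1 (tour_leave u) is Some (j, s) then (j, (flip * u.2 * s)%g)
  else tour_reverse u.

Lemma flip0 : flip (inord 0) = inord 0.
Proof. by rewrite tpermD // -val_eqE /= !inordK. Qed.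
Lemma flip1 : flip (inord 1) = inord 1.
Proof. by rewrite tpermD // -val_eqE /= !inordK. Qed.
Lemma flip2 : flip (inord 2) = inord 3. Proof. exact: tpermL. Qed.
Lemma flip3 : flip (inord 3) = inord 2. Proof. exact: tpermR. Qed.

Lemma tour_reverseK : involutive tour_reverse.
Proof. by case=> i p; rewrite /tour_reverse /= mulgA tperm2 mul1g. Qed.

Lemma tour_next_glued u j s : glue T u.1 (tour_leave u) = Some (j, s) ->
  tour_reverse (tour_next u) = (j, (u.2 * s)%g).
Proof.
by move=> E; rewrite /tour_next E /tour_reverse /= !mulgA tperm2 mul1g.
Qed.

(** Reversal conjugates the step to its inverse. *)
Lemma tour_reverse_next u : tour_next (tour_reverse (tour_next u)) = tour_reverse u.
Proof.
case E : (glue T u.1 (tour_leave u)) => [[j s]|]; last first.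
  by rewrite {2}/tour_next E tour_reverseK /tour_next E.
rewrite (tour_next_glued E) /tour_next /tour_leave /= permM (glue_sym E).
by rewrite /tour_reverse -mulgA mulgK.
Qed.

Lemma tour_next_inj : injective tour_next.
Proof.
apply: (@can_inj _ _ _ (fun u => tour_reverse (tour_next (tour_reverse u)))) => u.
by rewrite tour_reverse_next tour_reverseK.
Qed.

Lemma tour_cost_reverse_next u :
  tour_cost (tour_reverse (tour_next u)) = - tour_cost u.
Proof.
case E : (glue T u.1 (tour_leave u)) => [[j s]|]; last first.
  by rewrite /tour_next E tour_reverseK /tour_cost /crossing E oppr0.
rewrite (tour_next_glued E) /tour_cost /crossing E /tour_leave /tour_lower /= !permM.
by rewrite (glue_sym E) !permK opprB.
Qed.

Lemma tour_step_next u : glue T u.1 (tour_leave u) != None ->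
  tour_step T u (tour_next u).
Proof.
rewrite /tour_step /tour_next; case: (glue T _ _) => [[j s]|//] _.
by rewrite /tour_lower /tour_upper /tour_enter /tour_leave /= !permM flip0 flip1
  flip2 !eqxx.
Qed.

Lemma quad_coordC i a b : quad_coord q i a b = quad_coord q i b a.
Proof. by apply: eq_bigl => k; rewrite /same_side eq_sym. Qed.

(** If the orbit never meets the boundary, it is a tour and this is the matching
equation of its edge.  Otherwise the orbit contains a state and its reversal, so it
is closed under reversal, and every crossing is compensated by the crossing in the
opposite direction. *)
Lemma sum_tour_cost (x : tour_state n) : quad_matching T q ->
  \sum_(u <- orbit tour_next x) tour_cost u = 0.
Proof.
move=> qm; pose O := orbit tour_next x.
have sym := fconnect_sym tour_next_inj.
have [glued|/allPn[y xy]] := boolP (all (fun u => glue T u.1 (tour_leave u) != None) O).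
  have cO : ucycle (tour_step T) O.
    rewrite /ucycle orbit_uniq andbT.
    apply: sub_in_cycle glued (cycle_orbit tour_next_inj x) => u v gu _ /eqP <-.
    exact: tour_step_next.
  have costE u : u \in O -> tour_cost u =
      quad_coord q u.1 (tour_lower u) (tour_leave u) -
      quad_coord q (tour_next u).1 (tour_lower (tour_next u)) (tour_enter (tour_next u)).
    move=> /(allP glued); rewrite /tour_cost /crossing /tour_next.
    case: (glue _ _ _) => [[j s]|//] _.
    rewrite /tour_lower /tour_enter /= !permM flip0 flip2.
    by rewrite quad_coordC [X in _ - X = _]quad_coordC.
  rewrite (eq_big_seq _ costE) sumrB -(qm O cO) -/O.
  rewrite !big_uniq ?orbit_uniq //=; apply/eqP; rewrite subr_eq0; apply/eqP.
  rewrite (reindex_inj tour_next_inj); apply: eq_bigl => u.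
  by rewrite -!fconnect_orbit -(same_fconnect1_r tour_next_inj).
rewrite negbK => /eqP gy.
have yrev : tour_next y = tour_reverse y by rewrite /tour_next gy.
have rev_closed z : fconnect tour_next y z -> fconnect tour_next y (tour_reverse z).
  move=> /iter_findex <-; elim: (findex _ _ _) => [|k IHk].
    by rewrite -yrev fconnect1.
  apply: connect_trans IHk _; rewrite sym -(tour_reverse_next (iter k _ y)).
  exact: fconnect1.
have S0 : \sum_(u | fconnect tour_next y u) tour_cost u = 0.
  set S := LHS; suff : S = - S by lra.
  rewrite {1}/S (reindex_inj (h := tour_reverse \o tour_next)) /=; last first.
    exact: inj_comp (can_inj tour_reverseK) tour_next_inj.
  rewrite -sumrN; apply: eq_big => [u|u _]; last exact: tour_cost_reverse_next.
  apply/idP/idP => [|yu].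
    move=> /rev_closed; rewrite tour_reverseK => yu.
    by apply: connect_trans yu _; rewrite sym fconnect1.
  by apply: rev_closed; apply: connect_trans yu (fconnect1 _ _).
rewrite big_uniq ?orbit_uniq //= -[RHS]S0; apply: eq_bigl => u.
rewrite -fconnect_orbit; apply: same_connect; first exact: sym.
by rewrite fconnect_orbit.
Qed.

(** Symmetrized under reversal, so as to depend only on the tetrahedron, the edge
and the end of the edge: both directions of touring describe the same point. *)
Definition tour_potential u : R :=
  (potential tour_next tour_cost u +
   potential tour_next tour_cost (tour_reverse u)) / 2.

Lemma tour_potential_reverse u :
  tour_potential (tour_reverse u) = tour_potential u.
Proof. by rewrite /tour_potential tour_reverseK addrC. Qed.

Lemma tour_potential_next u : quad_matching T q ->
  tour_potential (tour_next u) = tour_potential u + tour_cost u.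
Proof.
move=> qm; have PE := potentialE tour_next_inj (fun x => sum_tour_cost x qm).
have := PE (tour_reverse (tour_next u)).
rewrite tour_reverse_next tour_cost_reverse_next /tour_potential PE => ->.
by lra.
Qed.

Lemma ord4P (P : 'I_4 -> Prop) :
  P (inord 0) -> P (inord 1) -> P (inord 2) -> P (inord 3) -> forall k, P k.
Proof.
move=> H0 H1 H2 H3 k; rewrite -(inord_val k).
by case: k => -[|[|[|[|//]]]].
Qed.

Lemma perm4_two_points (c f : 'I_4) : c != f ->
  exists p : 'S_4, p (inord 0) = c /\ p (inord 3) = f.
Proof.
move=> cf; exists (tperm (inord 3) (tperm (inord 0) c f) * tperm (inord 0) c)%g.
have w0 : tperm (inord 0) c f != inord 0.
  by rewrite -[X in _ != X](tpermR (inord 0) c) (inj_eq perm_inj) eq_sym.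
rewrite !permM (tpermD (z := inord 0)) //; last by rewrite -val_eqE /= !inordK.
by rewrite !tpermL tpermK.
Qed.

(** The point with barycentric coordinates [b] lies inside the edge from the lower to
the upper vertex of the state [p], and [c] is the lower one. *)
Definition edge_at (c : 'I_4) (b : 'rV[R]_4) (p : 'S_4) :=
  [&& p (inord 0) == c, b ord0 (p (inord 1)) != 0,
      b ord0 (p (inord 2)) == 0 & b ord0 (p (inord 3)) == 0].

(** A solution of the crossing equations at single points other than vertices, given
by the dimension of the face carrying the point.  Inside an edge it is the potential
along its tour; inside a face, the crossing cost is split evenly between the two
sides; inside a tetrahedron there is no equation. *)
Definition point_potential (i : 'I_n) (c : 'I_4) (b : 'rV[R]_4) : R :=
  if [pick p | edge_at c b p] is Some p then tour_potential (i, p)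
  else if [pick p : 'S_4 | (p (inord 0) == c) && (b ord0 (p (inord 3)) == 0)]
    is Some p then - tour_cost (i, p) / 2
  else 0.

(** Exactly two states fit a point inside an edge, and they are reversals of each
other. *)
Lemma point_potential_edge i c (b : 'rV[R]_4) p : edge_at c b p ->
  point_potential i c b = tour_potential (i, p).
Proof.
move=> pe; rewrite /point_potential; case: pickP => [p' p'e|/(_ p)]; last by rewrite pe.
case/and4P: pe => /eqP p0 p1 p2 p3; case/and4P: p'e => /eqP p'0 p'1 p'2 p'3.
have H k : exists l, p' k = p l.
  by exists ((p^-1)%g (p' k)); rewrite permKV.
have E1 : p' (inord 1) = p (inord 1).
  have [l El] := H (inord 1); move: El p'1; move: l.
  apply: ord4P => [El|//|->|->]; rewrite ?p2 ?p3 //.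
  move: El; rewrite p0 -p'0 => /perm_inj /(congr1 val) /=.
  by rewrite !inordK.
have E23 k : k != inord 0 -> b ord0 (p' k) == 0 ->
    p' k = p (inord 2) \/ p' k = p (inord 3).
  move=> k0; have [l El] := H k; move: El; move: l.
  apply: ord4P => [El|->|->|->] b0; [|by rewrite b0 in p1|by left|by right].
  by move: El k0; rewrite p0 -p'0 => /perm_inj ->; rewrite eqxx.
have [||E2|E2] := E23 (inord 2); rewrite ?p'2 // -?val_eqE /= ?inordK //;
have [||E3|E3] := E23 (inord 3); rewrite ?p'3 // -?val_eqE /= ?inordK //.
- by move: E3; rewrite -E2 => /perm_inj /(congr1 val) /=; rewrite !inordK.
- suff -> : p' = p by [].
  by apply/permP; apply: ord4P => //; rewrite p'0 p0.
- suff -> : (i, p') = tour_reverse (i, p) by rewrite tour_potential_reverse.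
  congr pair; apply/permP; apply: ord4P; rewrite permM.
  + by rewrite flip0 p0 p'0.
  + by rewrite flip1.
  + by rewrite flip2.
  + by rewrite flip3.
- by move: E3; rewrite -E2 => /perm_inj /(congr1 val) /=; rewrite !inordK.
Qed.

Lemma point_potential_face i c (b : 'rV[R]_4) (p : 'S_4) : p (inord 0) = c -> b ord0 c != 0 ->
  b ord0 (p (inord 1)) != 0 -> b ord0 (p (inord 2)) != 0 ->
  b ord0 (p (inord 3)) = 0 ->
  point_potential i c b = - tour_cost (i, p) / 2.
Proof.
move=> p0 bc p1 p2 p3.
have H (p' : 'S_4) k : b ord0 (p' k) = 0 -> p' k = p (inord 3).
  have : exists l, p' k = p l by exists ((p^-1)%g (p' k)); rewrite permKV.
  case=> l ->; move: l; apply: ord4P => // /eqP; last 2 first.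
  - by rewrite (negPf p1).
  - by rewrite (negPf p2).
  by rewrite p0 (negPf bc).
rewrite /point_potential; case: pickP => [p' /and4P[_ _ /eqP p'2 /eqP p'3]|_].
  move: (H _ _ p'2); rewrite -(H _ _ p'3) => /perm_inj /(congr1 val) /=.
  by rewrite !inordK.
case: pickP => [p' /andP[/eqP p'0 /eqP p'3]|/(_ p)]; last by rewrite p0 p3 !eqxx.
by rewrite /tour_cost /tour_leave /tour_lower /= (H _ _ p'3) p0 p'0.
Qed.

Lemma point_potential_crossing i f j (s : 'S_4) c d (b b' : 'rV[R]_4) :
  quad_matching T q -> glue T i f = Some (j, s) -> b ord0 f = 0 ->
  (forall v, b' ord0 (s v) = b ord0 v) ->
  b ord0 c != 0 -> d != c -> b ord0 d != 0 ->
  point_potential j (s c) b' = point_potential i c b + crossing i f c.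
Proof.
move=> qm E bf bb' bc dc bd.
have cf : c != f by apply: contraNneq bc => ->; rewrite bf.
have [p [p0 p3 p1]] : exists p : 'S_4, [/\ p (inord 0) = c, p (inord 3) = f
    & b ord0 (p (inord 1)) != 0].
  have [p [p0 p3]] := perm4_two_points cf.
  have [p1|p1] := eqVneq (b ord0 (p (inord 1))) 0; last by exists p.
  exists (tperm (inord 1) (inord 2) * p)%g; rewrite !permM.
  rewrite (tpermD (z := inord 0)) -?val_eqE /= ?inordK //.
  rewrite (tpermD (z := inord 3)) -?val_eqE /= ?inordK // tpermL; split=> //.
  have : exists l, d = p l by exists ((p^-1)%g d); rewrite permKV.
  case=> l dl; move: dl bd dc; move: l.
  by apply: ord4P => ->; rewrite ?p0 ?p1 ?p3 ?bf ?eqxx.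
have Ec : crossing i f c = tour_cost (i, p).
  by rewrite /tour_cost /tour_leave /tour_lower /= p0 p3.
have Ep : glue T (i, p).1 (tour_leave (i, p)) = Some (j, s) by rewrite /tour_leave /= p3.
rewrite Ec; have [p2|p2] := eqVneq (b ord0 (p (inord 2))) 0.
  rewrite (@point_potential_edge i c b p); last first.
    by apply/and4P; split; rewrite ?p0 ?p2 ?p3 ?bf.
  rewrite -tour_potential_next //.
  have -> : tour_next (i, p) = (j, (flip * p * s)%g) by rewrite /tour_next Ep.
  apply: point_potential_edge; apply/and4P.
  by rewrite !permM flip0 flip1 flip2 flip3 !bb' p0 p2 p3 bf !eqxx; split.
rewrite (point_potential_face _ p0) //; last by rewrite p3.
rewrite (@point_potential_face j (s c) b' (p * s)%g); rewrite ?permM ?bb' ?p0 ?p3 //.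
rewrite -(tour_next_glued Ep) tour_cost_reverse_next; lra.
Qed.

End States.

(** * Points of the realization *)

Section Realization.
Context (R : realType) (n : nat) (T : triangulation n).
Local Notation X := (tetrahedra R n).
Local Notation M := (realization R T).
Implicit Types (x z w : X).

Definition cls x : M := \pi_({eq_quot (@same_point R n T)}) x.

Definition rep (y : M) : X := generic_quotient.repr y.

Lemma cls_rep (y : M) : cls (rep y) = y.
Proof. exact: reprK. Qed.

(** The relation [glued] generates the identifications of the realization. *)
Lemma clsP x z : cls x = cls z <-> clos_refl_sym_trans _ (glued T) x z.
Proof.
split=> [/eqmodP /asboolP //|xz].
by apply/eqmodP; apply/asboolP.
Qed.

Lemma cls_continuous : continuous cls.
Proof. exact: pi_continuous. Qed.

Lemma open_cls (U : set M) : open (cls @^-1` U) -> open U.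
Proof. by []. Qed.

Definition bcoord x v : R := bary x ord0 v.

Definition glued_at x z f (s : 'S_4) : Prop :=
  [/\ glue T (projT1 x) f = Some (projT1 z, s), bcoord x f = 0
    & forall v, bcoord z (s v) = bcoord x v].

Lemma glued_atS x z f s : glued_at x z f s -> glued_at z x (s f) (s^-1)%g.
Proof.
case=> g xf xz; split; [exact: glue_sym g|by rewrite xz|].
by move=> v; rewrite -xz permKV.
Qed.

Lemma cls_glued x z f s : glued_at x z f s -> cls x = cls z.
Proof. by move=> g; apply/clsP; apply: rst_step; exists f, s. Qed.

(** Induction along chains of face gluings from [x]. *)
Lemma cls_ind x (Q : X -> Prop) : Q x ->
  (forall z w f s, cls z = cls x -> glued_at z w f s -> Q z -> Q w) ->
  forall z, cls x = cls z -> Q z.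
Proof.
move=> Qx Qg z /clsP.
suff H a b : clos_refl_sym_trans _ (glued T) a b -> cls a = cls x ->
    (Q a -> Q b) /\ (Q b -> Q a).
  by move=> /H /(_ erefl) [+ _]; apply.
elim=> {a b} [a b [f [s g]] ax|//|a b ab IH bx|a b c ab IHab bc IHbc ax].
- split; first exact: Qg g.
  by apply: Qg (glued_atS g); rewrite -(cls_glued g).
- by have /clsP ab' := ab; case: IH; first by rewrite ab'.
- have /clsP ab' := ab; case: (IHab ax) => H1 H2.
  by case: IHbc => [|H3 H4]; [rewrite -ab'|split=> [/H1/H3|/H4/H2]].
Qed.

Lemma bary_simplex x : simplex3 R (bary x).
Proof. exact: set_valP. Qed.

Lemma bcoord_ge0 x v : 0 <= bcoord x v.
Proof. by case: (bary_simplex x) => H _; exact: H. Qed.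

Lemma bcoord_sum x : \sum_v bcoord x v = 1.
Proof. by case: (bary_simplex x). Qed.

Definition mkpoint i (b : 'rV[R]_4) (hb : simplex3 R b) : X :=
  existT _ i (exist _ b (mem_set hb)).

Lemma bcoord_mkpoint i b hb v : bcoord (@mkpoint i b hb) v = b ord0 v.
Proof. by []. Qed.

Lemma eq_point x z : projT1 x = projT1 z -> bcoord x =1 bcoord z -> x = z.
Proof.
rewrite /bcoord /bary; case: x => i [b hb]; case: z => j [b' hb'] /= ij.
case: _ / ij => E.
have bb' : b = b' by apply/rowP => v; exact: E.
by case: _ / bb' in hb' E *; congr existT; congr exist; exact: Prop_irrelevance.
Qed.

Definition tetra_close (e : R) x z :=
  projT1 z = projT1 x /\ forall v, `|bcoord z v - bcoord x v| < e.

Lemma near_point x (e : R) : 0 < e -> nbhs x [set z | tetra_close e x z].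
Proof.
case: x => i b e0.
suff H : nbhs b [set b' : set_type (simplex3 R) |
    forall v, `|set_val b' ord0 v - set_val b ord0 v| < e].
  rewrite /nbhs /= /sigT_nbhs /=; apply: filterS H => b' Hb'.
  by split.
exact: (@initial_continuous _ _ (set_val : simplex3 R -> _) b _ (coord_near _ e0)).
Qed.

Lemma point_near x (U : set X) : nbhs x U ->
  exists2 e : R, 0 < e & forall z, tetra_close e x z -> U z.
Proof.
case: x => i b; rewrite /nbhs /= /sigT_nbhs /= => -[_ [[B oB <-] /= Bb] sB].
have /near_coord[e e0 He] : nbhs (set_val b) B by apply: open_nbhs_nbhs.
exists e => // -[j b'] [/= ji]; subst j; rewrite /bcoord /bary /= => Hb'.
by apply: (sB b'); apply: He.
Qed.

Lemma close_near (e : R) x z : tetra_close e x z -> \forall w \near z, tetra_close e x w.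
Proof.
case=> zx Hz.
have : \forall w \near nbhs z, forall v, tetra_close (e - `|bcoord z v - bcoord x v|) z w.
  have FF : Filter (nbhs z) by exact: nbhs_filter.
  apply: (@filter_forall X _ (fun v =>
    [set w | tetra_close (e - `|bcoord z v - bcoord x v|) z w]) (nbhs z) FF) => v.
  by apply: near_point; rewrite subr_gt0.
apply: filterS => w Hw; split; first by case: (Hw ord0) => ->.
move=> v; case: (Hw v) => _ /(_ v); have := Hz v.
move=> ? ?; rewrite -(subrK (bcoord z v) (bcoord w v)) -addrA.
by apply: le_lt_trans (ler_normD _ _) _; lra.
Qed.

(** A gluing only permutes barycentric coordinates, so a point has finitely many
representatives and they share the multiset of coordinates. *)
Lemma cls_perm x z : cls x = cls z -> exists s : 'S_4, forall v, bcoord z (s v) = bcoord x v.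
Proof.
move: z; apply: cls_ind; first by exists 1%g => v; rewrite perm1.
move=> z w f s _ [_ _ E] [s' Hs']; exists (s' * s)%g => v.
by rewrite permM E Hs'.
Qed.

Lemma big_bcoord_unique x c d : 1 / 2 < bcoord x c -> 1 / 2 < bcoord x d -> c = d.
Proof.
move=> hc hd; apply/eqP/negPn/negP => cd.
have := bcoord_sum x; rewrite (bigD1 c) //= (bigD1 d) /=; last by rewrite eq_sym.
have : 0 <= \sum_(i < 4 | (i != c) && (i != d)) bcoord x i.
  by apply: sumr_ge0 => v _; exact: bcoord_ge0.
by lra.
Qed.

Definition corner x : 'I_4 := odflt ord0 [pick c | 1 / 2 < bcoord x c].

Lemma cornerE x c : 1 / 2 < bcoord x c -> corner x = c.
Proof.
move=> hc; rewrite /corner; case: pickP => [d hd|/(_ c)]; last by rewrite hc.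
exact: big_bcoord_unique hd hc.
Qed.

(** A radius below which the combinatorics around the class of [x] is visible: a
point closer than [e] to [x] vanishes only in coordinates where [x] does, distinct
representatives in one tetrahedron are too far apart to be both that close, and a
coordinate of [x] above one half stays so. *)
Definition fine_scale (e : R) x := [/\ 0 < e, forall v, bcoord x v != 0 -> e <= bcoord x v,
  forall v u, bcoord x v != bcoord x u -> 2 * e <= `|bcoord x v - bcoord x u|
  & forall v, 1 / 2 < bcoord x v -> e <= bcoord x v - 1 / 2].

Lemma fine_cls e x z : cls x = cls z -> fine_scale e x -> fine_scale e z.
Proof.
move=> /cls_perm[s Hs] [e0 H1 H2 H3].
have E v : bcoord z v = bcoord x ((s^-1)%g v) by rewrite -Hs permKV.
by split=> // [v|v w|v]; rewrite !E; [exact: H1|exact: H2|exact: H3].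
Qed.

Lemma ex_fine x : exists e, fine_scale e x.
Proof.
have near_le (y : R) : 0 < y -> \forall e \near (0 : R)^'+, e <= y.
  by move=> y0; exact: nbhs_right_le.
have near_imp (b : bool) (P : R -> Prop) : (b -> \forall e \near (0 : R)^'+, P e) ->
    \forall e \near (0 : R)^'+, b -> P e.
  case: b => [/(_ isT) HP|_]; last exact: nearW.
  by apply: filterS HP.
have h1 : \forall e \near (0 : R)^'+, forall v, bcoord x v != 0 -> e <= bcoord x v.
  apply: filter_forall => v; apply: near_imp => v0; apply: near_le.
  by rewrite lt_neqAle eq_sym v0 bcoord_ge0.
have h2 : \forall e \near (0 : R)^'+, forall v u, bcoord x v != bcoord x u ->
    e <= `|bcoord x v - bcoord x u| / 2.
  apply: filter_forall => v; apply: filter_forall => w; apply: near_imp => vw.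
  by apply: near_le; rewrite divr_gt0 // normr_gt0 subr_eq0.
have h3 : \forall e \near (0 : R)^'+, forall v, 1 / 2 < bcoord x v -> e <= bcoord x v - 1 / 2.
  apply: filter_forall => v; apply: near_imp => v0; apply: near_le.
  by rewrite subr_gt0.
have h4 : \forall e \near (0 : R)^'+, 0 < e by exact: nbhs_right_gt.
have [e [H1 [H2 [H3 H4]]]] := filter_ex (filterI h1 (filterI h2 (filterI h3 h4))).
exists e; split=> // v w /H2; rewrite ler_pdivlMr //; lra.
Qed.

(** A gluing available at a point near [x] is available at [x] itself; hence the set
of points near some representative is saturated. *)
Lemma close_glued e x x' w' f s : fine_scale e x -> tetra_close e x x' -> glued_at x' w' f s ->
  exists2 w, glued_at x w f s & tetra_close e w w'.
Proof.
move=> [e0 H1 _ _] [xx' Hx'] [g x'f E].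
have xf : bcoord x f = 0.
  apply/eqP; apply: contraT => /H1; have := Hx' f.
  by rewrite x'f sub0r normrN ger0_norm ?bcoord_ge0 //; lra.
pose b : 'rV[R]_4 := \row_v bcoord x ((s^-1)%g v).
have hb : simplex3 R b.
  split=> [v|]; first by rewrite mxE bcoord_ge0.
  rewrite -(bcoord_sum x) (reindex_inj (@perm_inj _ s)); apply: eq_bigr => v _.
  by rewrite mxE permK.
exists (mkpoint (projT1 w') hb).
  by split=> //=; [rewrite -xx'|move=> v; rewrite bcoord_mkpoint mxE permK].
by split=> // v; rewrite bcoord_mkpoint mxE -{1}(permKV s v) E.
Qed.

Lemma close_unique e x z w : fine_scale e x -> cls x = cls z -> tetra_close e x w ->
  tetra_close e z w -> x = z.
Proof.
move=> [_ _ H2 _] /cls_perm[s Hs] [wx Hx] [wz Hz].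
apply: eq_point => [|v]; first by rewrite -wx.
apply/eqP; apply: contraT; have := Hx v; have := Hz v.
have -> : bcoord z v = bcoord x ((s^-1)%g v) by rewrite -Hs permKV.
rewrite distrC => h1 h2 /H2; have := ler_distD (bcoord w v) (bcoord x v) (bcoord x ((s^-1)%g v)).
by rewrite [`|bcoord w v - _|]distrC [`|bcoord x v - bcoord w v|]distrC; lra.
Qed.

End Realization.

(** * Local solutions of the standard matching equations *)

Section LocalSections.
Context (R : realType) (n : nat) (T : triangulation n) (q : 'M[R]_(n, 3)).
Hypothesis qm : quad_matching T q.
Local Notation X := (tetrahedra R n).
Local Notation M := (realization R T).
Local Notation cls := (@cls R n T).
Implicit Types (x z w : X) (y : M) (N : set M) (s : X -> R).

(** A solution of the crossing equations over the open set [N], as a function on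
points of the tetrahedra rather than on corners: a point may have several
representatives in the same corner of the same tetrahedron. *)
Record local_section N s : Prop := LocalSection {
  section_open : open N;
  section_corner : forall x, N (cls x) -> exists c, 1 / 2 < bcoord x c;
  section_glued : forall x z f (p : 'S_4) c, N (cls x) -> glued_at T x z f p ->
    1 / 2 < bcoord x c -> s z = s x + crossing T q (projT1 x) f c;
  section_locally_constant : forall x, N (cls x) ->
    \forall z \near x, s z = s x }.

(** Points with a barycentric coordinate above one half belong to a unique corner;
the vertices themselves are excluded, for there the equations concern a whole link
at once. *)
Definition near_vertex : set M :=
  [set y | exists c, 1 / 2 < bcoord (rep y) c < 1].

(** Every point near a representative of [y] receives the value of
[point_potential] at that representative. *)
Lemma ex_local_section y : near_vertex y ->
  exists Ns : set M * (X -> R), local_section Ns.1 Ns.2 /\ Ns.1 y.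
Proof.
move=> [c0 /andP[c0h c01]].
have [e fe] := ex_fine (rep y); have [e0 _ _ _] := fe.
pose a x := point_potential T q (projT1 x) (corner x) (bary x).
pose over w := [set x | cls (rep y) = cls x /\ tetra_close e x w].
pose s w := a (xget w (over w)).
have sE w x : over w x -> s w = a x.
  move=> wx; rewrite /s; case: xgetP => [x' _ wx'|/(_ x)//].
  have [yx xw] := wx; have [yx' x'w] := wx'; congr (a _).
  by apply: (@close_unique _ _ T _ _ _ _ (fine_cls yx' fe) _ x'w xw); rewrite -yx' yx.
have over_glued w x z f p : over w x -> glued_at T w z f p ->
    exists2 x', glued_at T x x' f p & over z x'.
  move=> [yx xw] g; have [x' g' x'z] := close_glued (fine_cls yx fe) xw g.
  by exists x' => //; split=> //; rewrite yx (cls_glued g').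
pose N := [set y' : M | exists x, over (rep y') x].
have NE w : N (cls w) <-> exists x, over w x.
  have H w1 w2 : cls w1 = cls w2 -> (exists x, over w1 x) -> exists x, over w2 x.
    move=> + H1; move: w2; apply: (@cls_ind _ _ T) => // z1 z2 f p _ g [x zx].
    by have [x' _ wx'] := over_glued _ _ _ _ _ zx g; exists x'.
  by split; apply: H; rewrite cls_rep.
have corner_class x : cls (rep y) = cls x -> exists c, 1 / 2 < bcoord x c < 1.
  by move=> /cls_perm[p Hp]; exists (p c0); rewrite Hp c0h c01.
have over_corner w x c : over w x -> 1 / 2 < bcoord x c -> 1 / 2 < bcoord w c.
  move=> [yx [_ /(_ c)]]; have [_ _ _ H3] := fine_cls yx fe.
  by rewrite ltr_distl => /andP[? _] /H3; lra.
exists (N, s); split=> /=; last first.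
  rewrite -[y]cls_rep NE; exists (rep y); split=> //; split=> // v.
  by rewrite subrr normr0.
split.
- apply: open_cls; rewrite openE => w /= /NE[x [yx xw]].
  rewrite /interior; apply: filterS (close_near xw) => w' xw'.
  by apply/NE; exists x.
- move=> w /NE[x wx]; have [yx _] := wx; have [c /andP[ch _]] := corner_class x yx.
  by exists c; apply: over_corner wx ch.
- move=> w z f p c /NE[x wx] g wc.
  have [x' g' zx'] := over_glued _ _ _ _ _ wx g.
  rewrite (sE _ _ wx) (sE _ _ zx').
  have [c' /andP[c'h c'1]] : exists c, 1 / 2 < bcoord x c < 1 by apply: corner_class; case: wx.
  have Ec : c' = c by apply: big_bcoord_unique wc; apply: over_corner wx c'h.
  subst c.
  have [gg xf E] := g'.
  have [d dc xd] : exists2 d, d != c' & bcoord x d != 0.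
    apply: contrapT => H; move: c'1; suff -> : bcoord x c' = 1 by rewrite ltxx.
    rewrite -(bcoord_sum x) (bigD1 c') //= big1 ?addr0 // => d dc.
    by apply/eqP; apply: contraT => xd; case: H; exists d.
  have [_ [-> _]] := wx.
  rewrite /a (cornerE c'h) (@cornerE _ _ x' (p c')) ?E //.
  have xc' : bcoord x c' != 0 by apply: lt0r_neq0; lra.
  exact: (point_potential_crossing qm gg xf E xc' dc xd).
- move=> w /NE[x wx]; have [yx xw] := wx.
  apply: filterS (close_near xw) => w' xw'.
  by rewrite (sE _ _ wx) (sE w' x).
Qed.

Lemma ex_local_sections : exists Ns : M -> set M * (X -> R), forall y,
  near_vertex y -> local_section (Ns y).1 (Ns y).2 /\ (Ns y).1 y.
Proof.
have H y : exists Ns : set M * (X -> R),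
    near_vertex y -> local_section Ns.1 Ns.2 /\ Ns.1 y.
  have [yv|] := pselect (near_vertex y); last by exists (set0, fun=> 0).
  by have [Ns HNs] := ex_local_section yv; exists Ns.
by have [Ns HNs] := choice H; exists Ns.
Qed.

(** Both sections satisfy the same equations, so their difference descends to the
realization. *)
Lemma section_diff N N' s s' x z : local_section N s -> local_section N' s' ->
  N (cls x) -> N' (cls x) -> cls x = cls z -> s x - s' x = s z - s' z.
Proof.
move=> lN lN' Nx N'x; move: z; apply: (@cls_ind _ _ T) => // z w f p zx g ->.
rewrite -zx in Nx N'x; have [c zc] := section_corner lN Nx.
by rewrite (section_glued lN Nx g zc) (section_glued lN' N'x g zc); lra.
Qed.

Lemma section_diff_near N N' s s' y : local_section N s -> local_section N' s' ->
  N y -> N' y -> \forall z \near y,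
    s (rep z) - s' (rep z) = s (rep y) - s' (rep y).
Proof.
move=> lN lN' Ny N'y; set k := s (rep y) - s' (rep y).
pose O := [set z | [/\ N z, N' z & s (rep z) - s' (rep z) = k]].
have oO : open O.
  apply: open_cls; rewrite openE => w [Nw N'w]; rewrite /interior.
  have wE := @section_diff _ _ _ _ (rep (cls w)) _ lN lN'.
  rewrite cls_rep in wE; rewrite (wE w) // => kE.
  have cw := @cls_continuous R n T w.
  have nN : \forall z \near w, N (cls z).
    by apply: cw; apply: open_nbhs_nbhs; split=> //; exact: section_open lN.
  have nN' : \forall z \near w, N' (cls z).
    by apply: cw; apply: open_nbhs_nbhs; split=> //; exact: section_open lN'.
  have ns := section_locally_constant lN Nw.
  have ns' := section_locally_constant lN' N'w.
  apply: filterS2 (filterI nN nN') (filterI ns ns') => z [Nz N'z] [sz s'z].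
  split=> //; have -> := @section_diff _ _ _ _ (rep (cls z)) z lN lN' _ _ _;
    by rewrite ?cls_rep // sz s'z.
have : nbhs y O by apply: open_nbhs_nbhs.
by apply: filterS => z [].
Qed.

Context (Ns : M -> set M * (X -> R)).
Hypothesis NsP : forall y, near_vertex y ->
  local_section (Ns y).1 (Ns y).2 /\ (Ns y).1 y.

Definition transition y y' : R := (Ns y).2 (rep y') - (Ns y').2 (rep y').

Lemma transition_cocycle : cocycle_on near_vertex transition.
Proof.
move=> y yv; have [ly Nyy] := NsP yv.
have : nbhs y (Ns y).1 by apply: open_nbhs_nbhs; split=> //; exact: section_open ly.
apply: filterS => z Nyz zv; have [lz Nzz] := NsP zv.
apply: filterS (section_diff_near ly lz Nyz Nzz) => w E wv.
by rewrite /transition; lra.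
Qed.

End LocalSections.

(** * Charts at vertices *)

Lemma set_type_near (Y : topologicalType) (A : set Y) (u : set_type A)
    (P : set (set_type A)) : nbhs u P ->
  \forall y \near set_val u, forall h : A y, P (exist _ y (mem_set h)).
Proof.
move=> [_ [[B oB <-] /= Bu] BP]; have : nbhs (set_val u) B by apply: open_nbhs_nbhs.
by apply: filterS => y By h; apply: BP.
Qed.

(** A chart at [p] into the half-space, with the maps extended arbitrarily to total
functions, which keeps membership proofs out of the statements that use it. *)
Record chart_at (R : realType) (Y : topologicalType) (p : Y) (U : set Y)
    (V : set 'rV[R]_3) (F : Y -> 'rV[R]_3) (G : 'rV[R]_3 -> Y) : Prop := ChartAt {
  chart_open : open U;
  chart_point : U p;
  chart_target : forall z, V z -> \forall w \near z, half_space R w -> V w;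
  chart_half_space : V `<=` half_space R;
  chart_to : forall y, U y -> V (F y) /\ G (F y) = y;
  chart_from : forall z, V z -> U (G z) /\ F (G z) = z;
  chart_to_near : forall y, U y -> forall O, nbhs (F y) O ->
    \forall y' \near y, O (F y');
  chart_from_near : forall z, V z -> forall O, nbhs (G z) O ->
    \forall w \near z, V w -> O (G w) }.

Lemma ex_chart (R : realType) (Y : topologicalType) (p : Y) :
  compact_3manifold R Y -> exists U V F G, @chart_at R Y p U V F G.
Proof.
move=> [_ _ _ /(_ p) [U [W [oU Up oW]]]] [f [g [cf cg fK gK]]].
set V := W `&` half_space R.
pose F y : 'rV[R]_3 := if pselect (U y) is left h then
  set_val (f (exist _ y (mem_set h))) else 0.
pose G z : Y := if pselect (V z) is left h then
  set_val (g (exist _ z (mem_set h))) else p.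
have FE y (h : U y) : F y = set_val (f (exist _ y (mem_set h))).
  rewrite /F; case: pselect => // h'; congr (set_val (f _)).
  by congr exist; exact: Prop_irrelevance.
have GE z (h : V z) : G z = set_val (g (exist _ z (mem_set h))).
  rewrite /G; case: pselect => // h'; congr (set_val (g _)).
  by congr exist; exact: Prop_irrelevance.
have FV u : F (set_val u) = set_val (f u).
  rewrite (FE _ (set_valP u)); congr (set_val (f _)).
  exact: val_inj.
have GV v : G (set_val v) = set_val (g v).
  rewrite (GE _ (set_valP v)); congr (set_val (g _)).
  exact: val_inj.
exists U, V, F, G; split=> //.
- move=> z [Wz _]; have : nbhs z W by exact: open_nbhs_nbhs.
  by apply: filterS => w Ww Hw; split.
- by move=> z [].
- move=> y Uy; rewrite (FE y Uy); split; first exact: set_valP.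
  by rewrite GV fK.
- move=> z Vz; rewrite (GE z Vz); split; first exact: set_valP.
  by rewrite FV gK.
- move=> y Uy O; rewrite (FE y Uy) => Oy.
  have := cf _ _ (@initial_continuous _ _ (set_val : V -> _) _ _ Oy).
  move=> /set_type_near /= H.
  have : nbhs y U by exact: open_nbhs_nbhs.
  by apply: filterS2 H => y' Hy' Uy'; rewrite (FE y' Uy'); exact: Hy'.
- move=> z Vz O; rewrite (GE z Vz) => Oz.
  have := cg _ _ (@initial_continuous _ _ (set_val : U -> _) _ _ Oz).
  move=> /set_type_near /=.
  by apply: filterS => w Hw Vw; rewrite (GE w Vw); exact: Hw.
Qed.

Section CornerPotential.
Context (R : realType) (n : nat) (T : triangulation n) (q : 'M[R]_(n, 3)).
Hypothesis qm : quad_matching T q.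
Hypothesis mfd : compact_3manifold R (realization R T).
Local Notation X := (tetrahedra R n).
Local Notation M := (realization R T).
Local Notation cls := (@cls R n T).
Implicit Types (x : X).

Definition edge_row (e : R) (c d : 'I_4) : 'rV[R]_4 :=
  \row_v ((1 - e) * (v == c)%:R + e * (v == d)%:R).

Lemma edge_row_simplex e c d : 0 <= e <= 1 -> simplex3 R (edge_row e c d).
Proof.
move=> /andP[e0 e1]; split=> [v|].
  by rewrite mxE addr_ge0 // mulr_ge0 ?ler0n // subr_ge0.
have S (a : 'I_4) : \sum_v (v == a)%:R = 1 :> R.
  rewrite (bigD1 a) //= eqxx big1 ?addr0 // => v /negPf ->; by [].
under eq_bigr do rewrite mxE.
by rewrite big_split /= -!mulr_sumr !S !mulr1 subrK.
Qed.

Lemma itv01_0 : 0 <= (0 : R) <= 1. Proof. by rewrite lexx ler01. Qed.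

Definition vertex_point i c : X := mkpoint i (edge_row_simplex c c itv01_0).

Lemma bcoord_vertex_point i c v : bcoord (vertex_point i c) v = (v == c)%:R.
Proof. by rewrite bcoord_mkpoint mxE subr0 mul1r mul0r addr0. Qed.

(** A barycentric coordinate that reaches 1 leaves nothing for the others. *)
Lemma vertex_pointP x c : 1 <= bcoord x c -> x = vertex_point (projT1 x) c.
Proof.
move=> xc; apply: eq_point => // v; rewrite bcoord_vertex_point.
have := bcoord_sum x; rewrite (bigD1 c) //=.
have S0 : 0 <= \sum_(u < 4 | u != c) bcoord x u by apply: sumr_ge0 => u _; exact: bcoord_ge0.
move=> S1; have [->|vc] := eqVneq v c; first by rewrite ?eqxx /=; lra.
have : \sum_(u < 4 | u != c) bcoord x u = 0 by lra.
by move=> /psumr_eq0P -> // u _; exact: bcoord_ge0.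
Qed.

Lemma bcoord_le x c v : v != c -> bcoord x v <= 1 - bcoord x c.
Proof.
move=> vc; have := bcoord_sum x; rewrite (bigD1 c) //= (bigD1 v) //=.
have : 0 <= \sum_(u < 4 | (u != c) && (u != v)) bcoord x u.
  by apply: sumr_ge0 => u _; exact: bcoord_ge0.
by lra.
Qed.

Lemma vertex_point_glued i f j (s : 'S_4) c : glue T i f = Some (j, s) -> c != f ->
  cls (vertex_point i c) = cls (vertex_point j (s c)).
Proof.
move=> g cf; apply: (@cls_glued _ _ T _ _ f s); split=> //.
  by rewrite bcoord_vertex_point eq_sym (negPf cf).
by move=> v; rewrite !bcoord_vertex_point (inj_eq perm_inj).
Qed.

(** The open cone neighbourhoods of the vertex [p]. *)
Definition vertex_star (p : M) (l : R) : set M :=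
  [set y | exists c, l < bcoord (rep y) c /\ cls (vertex_point (projT1 (rep y)) c) = p].

Lemma vertex_starP p l x : 0 <= l -> vertex_star p l (cls x) <->
  exists c, l < bcoord x c /\ cls (vertex_point (projT1 x) c) = p.
Proof.
move=> l0; pose Q x := exists c, l < bcoord x c /\ cls (vertex_point (projT1 x) c) = p.
have H x1 x2 : cls x1 = cls x2 -> Q x1 -> Q x2.
  move=> + Q1; move: x2; apply: (@cls_ind _ _ T) => // z1 z2 f s _ [g zf E] [c [lc pc]].
  exists (s c); rewrite E; split=> //; rewrite -(vertex_point_glued g) //.
  by apply: contraTneq lc => ->; rewrite zf -leNgt.
by split; apply: H; rewrite cls_rep.
Qed.

Lemma vertex_star_open p l : 0 <= l -> open (vertex_star p l).
Proof.
move=> l0; apply: open_cls; rewrite openE => x /= /(vertex_starP _ _ l0) [c [lc pc]].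
rewrite /interior; have d0 : 0 < bcoord x c - l by rewrite subr_gt0.
apply: filterS (near_point x d0) => z [zx /(_ c)].
rewrite ltr_distl => /andP[? _]; apply/(vertex_starP _ _ l0).
by exists c; split; [lra|rewrite zx].
Qed.

Lemma vertex_star_near p l i c : 0 <= l -> l < 1 -> p = cls (vertex_point i c) ->
  nbhs p (vertex_star p l).
Proof.
move=> l0 l1 pE; apply: open_nbhs_nbhs; split; first exact: vertex_star_open.
by rewrite pE vertex_starP //; exists c; rewrite bcoord_vertex_point eqxx.
Qed.

(** The triangle coordinates around one vertex [p].  The link of [p] is realized as
the union [K] of the triangles at level [1 - e] in the corners at [p].  The radius
[r] of the shell keeps it inside the chart and inside the star of [p], the level [e]
is chosen so that [K] lies within distance [r] of the centre, and [d] is chosen so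
that [K] avoids the ball of radius [d].  The local solutions, corrected on the shell,
are then locally constant on each triangle of [K]. *)
Lemma corner_potential_at p : exists t : 'I_n -> 'I_4 -> R,
  forall i f j (s : 'S_4) c, glue T i f = Some (j, s) -> c != f ->
    cls (vertex_point i c) = p -> t j (s c) = t i c + crossing T q i f c.
Proof.
have [[i0 [c0 pE]]|nop] := pselect (exists i c, p = cls (vertex_point i c)); last first.
  by exists (fun _ _ => 0) => i f j s c _ _ icp; case: nop; exists i, c.
have [U [V [F [G ch]]]] := ex_chart p mfd.
have Up := chart_point ch; have [Vb Gb] := chart_to ch Up.
set b := F p in Vb Gb.
have half0 : 0 <= (1 / 2 : R) by lra.
have [r r0 [rb Hr]] : exists2 r : R, 0 < r & (b ord0 ord0 = 0 \/ r <= b ord0 ord0) /\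
    forall z : 'rV[R]_3, half_space R z -> (forall i, `|z ord0 i - b ord0 i| <= r) ->
    V z /\ vertex_star p (1 / 2) (G z).
  have pstar : nbhs (G b) (vertex_star p (1 / 2)).
    by rewrite Gb; apply: vertex_star_near pE => //; lra.
  have [e1 e10 He1] := near_coord (chart_target ch Vb).
  have [e2 e20 He2] := near_coord (chart_from_near ch Vb pstar).
  have b0 : 0 <= b ord0 ord0 by apply: (chart_half_space ch Vb).
  (* If b is interior, r is also at most its height, so that the shell is whole. *)
  pose r := Num.min (Num.min e1 e2 / 2) (if b ord0 ord0 == 0 then e1 else b ord0 ord0).
  have r0 : 0 < r.
    rewrite !lt_min; apply/andP; split; first by rewrite divr_gt0 // lt_min e10 e20.
    by case: eqP => // /eqP bn0; rewrite lt_neqAle eq_sym bn0.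
  have r12 : r < e1 /\ r < e2.
    have rh : r <= Num.min e1 e2 / 2 by rewrite ge_min lexx.
    have := ge_min e1 e1 e2; rewrite lexx /= => m1.
    have := ge_min e2 e1 e2; rewrite lexx orbT => m2.
    by split; lra.
  have [r1 r2] := r12.
  exists r => //; split.
    rewrite /r; case: eqP => [b00|_]; [by left|right].
    by rewrite ge_min lexx orbT.
  move=> z hz Hz; have Vz : V z by apply: He1 => // i; exact: le_lt_trans (Hz i) r1.
  by split=> //; apply: He2 => // i; exact: le_lt_trans (Hz i) r2.
have [e /andP[e0 e12] He] : exists2 e : R, 0 < e < 1 / 2 & forall x c,
    cls (vertex_point (projT1 x) c) = p -> bcoord x c = 1 - e ->
    U (cls x) /\ forall i, `|F (cls x) ord0 i - b ord0 i| <= r.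
  pose O := [set y | U y /\ forall i, `|F y ord0 i - b ord0 i| <= r].
  have pO : nbhs p O.
    have pU : nbhs p U by apply: open_nbhs_nbhs; split=> //; exact: chart_open ch.
    apply: filterS2 pU (chart_to_near ch Up (coord_near b r0)) => y Uy Fy.
    by split=> // i; exact: ltW.
  have nearK : \forall e \near (0 : R)^'+, forall i c x,
      cls (vertex_point i c) = p -> projT1 x = i -> bcoord x c = 1 - e -> O (cls x).
    apply: filter_forall => i; apply: filter_forall => c.
    have [icp|nicp] := pselect (cls (vertex_point i c) = p); last exact: nearW.
    have [e1 e10 He1] : exists2 e : R, 0 < e & forall x,
        tetra_close e (vertex_point i c) x -> O (cls x).
      by apply: point_near; apply: cls_continuous; rewrite icp.
    have g0 : \forall e \near (0 : R)^'+, 0 < e by exact: nbhs_right_gt.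
    have l1 : \forall e \near (0 : R)^'+, e < e1 by exact: nbhs_right_lt.
    apply: filterS2 g0 l1 => e e0 ee1 x _ xi xc; apply: He1; split=> // v.
    rewrite bcoord_vertex_point; have [->|vc] := eqVneq v c.
      by rewrite ?eqxx xc addrAC subrr sub0r normrN gtr0_norm.
    rewrite subr0 ger0_norm ?bcoord_ge0 //; have := bcoord_le x vc; lra.
  have g0 : \forall e \near (0 : R)^'+, 0 < e by exact: nbhs_right_gt.
  have l1 : \forall e \near (0 : R)^'+, e < 1 / 2 by apply: nbhs_right_lt; lra.
  have [e [He [e0 e1]]] := filter_ex (filterI nearK (filterI g0 l1)).
  exists e; first by rewrite e0.
  by move=> x c xp xc; exact: (He _ _ _ xp).
(* d: points of the chart this close to b come from above the level 1 - e. *)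
have [d /andP[d0 dr] Hd] : exists2 d : R, 0 < d < r & forall z : 'rV[R]_3, half_space R z ->
    (forall i, `|z ord0 i - b ord0 i| < d) -> vertex_star p (1 - e) (G z).
  have pstar : nbhs (G b) (vertex_star p (1 - e)).
    by rewrite Gb; apply: vertex_star_near pE => //; lra.
  have [d1 d10 Hd1] := near_coord (chart_from_near ch Vb pstar).
  exists (Num.min d1 (r / 2)).
    by rewrite lt_min d10 gt_min; apply/andP; split; [lra|apply/orP; right; lra].
  move=> z hz Hz; apply: Hd1.
    by move=> i; apply: lt_le_trans (Hz i) _; rewrite ge_min lexx.
  apply: (Hr z hz _).1 => i; apply: ltW; apply: lt_le_trans (Hz i) _.
  by rewrite ge_min; apply/orP; right; lra.
have shellV z : shell d r b z -> V z.
  by move=> [hz zr _]; have [] := Hr z hz zr.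
have shell_near z : shell d r b z -> near_vertex (G z).
  move=> zS; have Vz := shellV z zS; have [hz zr [k dk]] := zS.
  have [_ [c [hc pc]]] := Hr z hz zr.
  exists c; rewrite hc /= ltNge; apply/negP => /vertex_pointP xE.
  have GzE : G z = p by rewrite -pc -xE cls_rep.
  have [_ FG] := chart_from ch Vz.
  by move: dk; rewrite -FG GzE -/b subrr normr0; lra.
have [Ns NsP] := ex_local_sections qm.
have cS : cocycle_on (shell d r b) (fun u v => transition Ns (G u) (G v)).
  apply: (@cocycle_pullback R 'rV[R]_3 M G (shell d r b) (@near_vertex R n T)
    (transition Ns)) => //.
  - move=> z zS O /(chart_from_near ch (shellV z zS)).
    by apply: filterS => w Hw /shellV; exact: Hw.
  - exact: transition_cocycle NsP.
have [h hS] := splits_shell d0 dr rb cS.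
pose K i c := [set x | [/\ projT1 x = i, cls (vertex_point i c) = p & bcoord x c = 1 - e]].
have K_shell i c x : K i c x -> shell d r b (F (cls x)).
  move=> [xi pc xc]; have [|Ux Fr] := He x c _ xc; first by rewrite xi.
  have [VF GF] := chart_to ch Ux.
  split=> //; first exact: chart_half_space ch _ VF.
  apply: contrapT => H; have : vertex_star p (1 - e) (G (F (cls x))).
    apply: Hd; first exact: chart_half_space ch _ VF.
    by move=> k; rewrite ltNge; apply/negP => dk; apply: H; exists k.
  rewrite GF vertex_starP; last by lra.
  move=> [c' [hc' _]]; have Ec : c = c' by apply: (@big_bcoord_unique _ _ x); lra.
  by move: hc'; rewrite -Ec xc ltxx.
have K_U i c x : K i c x -> U (cls x).
  by move=> [xi pc xc]; have [] := He x c _ xc; rewrite ?xi.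
have K_GF i c x : K i c x -> G (F (cls x)) = cls x.
  by move=> Kx; have [] := chart_to ch (K_U _ _ _ Kx).
have K_nv i c x : K i c x -> near_vertex (cls x).
  by move=> Kx; rewrite -(K_GF _ _ _ Kx); apply: shell_near; exact: K_shell Kx.
pose S x := (Ns (cls x)).2 x + h (F (cls x)).
have S_near i c x : K i c x -> \forall z \near x, K i c z -> S z = S x.
  move=> Kx; have [lx Nx] := NsP _ (K_nv _ _ _ Kx).
  have cx := @cls_continuous R n T x.
  have nN : \forall z \near x, (Ns (cls x)).1 (cls z).
    by apply: cx; apply: open_nbhs_nbhs; split=> //; exact: section_open lx.
  have nh : \forall z \near x, shell d r b (F (cls z)) ->
      h (F (cls z)) = h (F (cls x)) + transition Ns (G (F (cls x))) (G (F (cls z))).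
    have /(chart_to_near ch (K_U _ _ _ Kx)) := hS _ (K_shell _ _ _ Kx).
    exact: cx.
  have ns := section_locally_constant lx Nx.
  apply: filterS2 (filterI nN nh) ns => z [Nz hz] sz Kz.
  have [lz Nzz] := NsP _ (K_nv _ _ _ Kz).
  rewrite /S (hz (K_shell _ _ _ Kz)) /transition !(K_GF i c) //.
  have := @section_diff _ _ T q _ _ _ _ (rep (cls z)) z lx lz.
  by rewrite cls_rep => /(_ Nz Nzz erefl); rewrite sz; lra.
have S_const i c x z : K i c x -> K i c z -> S x = S z.
  pose A := [set a : 'rV[R]_4 | simplex3 R a /\ a ord0 c = 1 - e].
  move=> Kx Kz; have [xi pc xc] := Kx; have [zi _ zc] := Kz.
  (* The triangle of K in this corner is convex in barycentric coordinates. *)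
  pose g (a : 'rV[R]_4) : R :=
    if pselect (simplex3 R a) is left ha then S (mkpoint i ha) else 0.
  have gE w : projT1 w = i -> g (bary w) = S w.
    move=> wi; rewrite /g; case: pselect => [ha|[]]; last exact: bary_simplex.
    by congr S; apply: eq_point.
  rewrite -(gE x) // -(gE z) //.
  apply: (@lc_connected_convex R 4 A) => //; last 2 first.
  - by split=> //; exact: bary_simplex.
  - by split=> //; exact: bary_simplex.
  - move=> y1 y2 t [[y10 y1S] y1c] [[y20 y2S] y2c] /andP[t0 t1]; split; last first.
      by rewrite !mxE y1c y2c subrr mulr0 addr0.
    split=> [v|]; first by rewrite !mxE; have := y10 v; have := y20 v; nra.
    under eq_bigr do rewrite !mxE.
    by rewrite big_split /= -mulr_sumr sumrB y1S y2S subrr mulr0 addr0.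
  move=> a [ha ac]; pose w := mkpoint i ha.
  have [k k0 Hk] := point_near (S_near i c w (And3 erefl pc ac)).
  apply: filterS (coord_near a k0) => a' Ha' [ha' a'c].
  rewrite (gE (mkpoint i ha') erefl) (gE w erefl); apply: Hk; last by split.
  by split.
have e01 : 0 <= e <= 1 by lra.
(* Any point of the triangle would do; this one lies on an edge at the corner c. *)
pose away (c : 'I_4) : 'I_4 := if c == ord0 then ord_max else ord0.
exists (fun i c => S (mkpoint i (edge_row_simplex c (away c) e01))).
have K_edge i c d' : cls (vertex_point i c) = p -> d' != c ->
    K i c (mkpoint i (edge_row_simplex c d' e01)).
  move=> pc dc; split=> //; rewrite bcoord_mkpoint mxE eqxx eq_sym (negPf dc).
  by rewrite mulr1 mulr0 addr0.
have away_neq c : away c != c by rewrite /away; case: (eqVneq c ord0) => [->|]; rewrite // eq_sym.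
move=> i f j s c g cf pc.
have [pi [pi0 pi3]] := perm4_two_points cf.
pose d' := pi (inord 1).
have dc : d' != c by rewrite -pi0 (inj_eq perm_inj) -val_eqE /= !inordK.
have df : d' != f by rewrite -pi3 (inj_eq perm_inj) -val_eqE /= !inordK.
have psc : cls (vertex_point j (s c)) = p by rewrite -(vertex_point_glued g cf).
have sdc : s d' != s c by rewrite (inj_eq perm_inj).
have Kx := K_edge i c d' pc dc; have Kz := K_edge j (s c) (s d') psc sdc.
rewrite (S_const _ _ _ _ (K_edge _ _ _ psc (away_neq _)) Kz).
rewrite (S_const _ _ _ _ (K_edge _ _ _ pc (away_neq _)) Kx).
move: Kx Kz; set x := mkpoint i _; set z := mkpoint j _ => Kx Kz.
have xz : glued_at T x z f s.
  split=> //; first by rewrite bcoord_mkpoint mxE eq_sym (negPf cf) eq_sym (negPf df) !mulr0 addr0.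
  by move=> v; rewrite !bcoord_mkpoint !mxE !(inj_eq perm_inj).
have [lx Nx] := NsP _ (K_nv _ _ _ Kx).
have xc : 1 / 2 < bcoord x c by have [_ _ ->] := Kx; lra.
by rewrite /S -(cls_glued xz) (section_glued lx Nx xz xc) addrAC.
Qed.

(** The solutions at different vertices are independent of each other, since a
crossing joins corners at the same vertex. *)
Lemma corner_potential : exists t : 'I_n -> 'I_4 -> R,
  forall i f j (s : 'S_4) c, glue T i f = Some (j, s) -> c != f ->
    t j (s c) = t i c + crossing T q i f c.
Proof.
have [t tP] := choice corner_potential_at.
exists (fun i c => t (cls (vertex_point i c)) i c) => i f j s c g cf.
by rewrite -(vertex_point_glued g cf); exact: tP.
Qed.

End CornerPotential.

(** * Vertices of a polytope *)

Section Polytope.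
Context (R : realType) (n m : nat) (D : set 'M[R]_(n, m)).
Hypothesis D0 : D 0.
Hypothesis D_linear : forall a x y, D x -> D y -> D (a *: x + y).
Implicit Types (x y z u : 'M[R]_(n, m)).

Definition nonneg x := forall i j, 0 <= x i j.

(** The solution spaces are the cases where [D] is the set of solutions of the
matching equations. *)
Definition polytope_of : set 'M[R]_(n, m) := [set x | nonneg_sum1 x /\ D x].
Local Notation P := polytope_of.

Lemma D_scale a x : D x -> D (a *: x).
Proof. by move=> Dx; rewrite -[_ *: _]addr0; exact: D_linear. Qed.

Lemma coord_sumD x y : coord_sum (x + y) = coord_sum x + coord_sum y.
Proof.
rewrite /coord_sum -big_split; apply: eq_bigr => i _.
by rewrite -big_split; apply: eq_bigr => j _; rewrite mxE.
Qed.

Lemma coord_sumZ a x : coord_sum (a *: x) = a * coord_sum x.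
Proof.
rewrite /coord_sum mulr_sumr; apply: eq_bigr => i _.
by rewrite mulr_sumr; apply: eq_bigr => j _; rewrite mxE.
Qed.

Lemma coord_sum0 : coord_sum (0 : 'M[R]_(n, m)) = 0.
Proof. by rewrite -(scale0r 0) coord_sumZ mul0r. Qed.

Lemma coord_sum_gt0 x : nonneg x -> x != 0 -> 0 < coord_sum x.
Proof.
move=> x0 xn0; rewrite lt_neqAle eq_sym; apply/andP; split; last first.
  by apply: sumr_ge0 => i _; apply: sumr_ge0.
apply: contraNneq xn0; rewrite /coord_sum => /psumr_eq0P S0.
apply/eqP/matrixP => i j; rewrite mxE; move: j isT; apply/psumr_eq0P => //.
by apply: S0 => // k _; apply: sumr_ge0.
Qed.

Lemma nonneg_sum1_neq0 x : nonneg_sum1 x -> x != 0.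
Proof.
by case=> _ s1; apply: contra_eq_neq s1 => ->; rewrite coord_sum0 eq_sym oner_neq0.
Qed.

Lemma proj_image_polytope x : nonneg x -> D x -> x != 0 -> P (proj_image x).
Proof.
move=> x0 Dx xn0; have s0 := coord_sum_gt0 x0 xn0; split; last exact: D_scale.
split=> [i j|]; first by rewrite mxE mulr_ge0 // invr_ge0 ltW.
by rewrite coord_sumZ mulVf // gt_eqF.
Qed.

Lemma proj_imageK x : nonneg x -> x != 0 -> coord_sum x *: proj_image x = x.
Proof.
by move=> x0 xn0; rewrite scalerA divff ?scale1r // gt_eqF // coord_sum_gt0.
Qed.

Lemma proj_image_id x : coord_sum x = 1 -> proj_image x = x.
Proof. by move=> s1; rewrite /proj_image s1 invr1 scale1r. Qed.

Lemma proj_imageZ a x : a != 0 -> proj_image (a *: x) = proj_image x.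
Proof.
by move=> a0; rewrite /proj_image coord_sumZ scalerA invfM mulrAC mulVf // mul1r.
Qed.

Lemma dominates_trans x y z : dominates x y -> dominates y z -> dominates x z.
Proof. by move=> xy yz i j /xy/yz. Qed.

Lemma dominatesZ x a : dominates x (a *: x).
Proof. by move=> i j; rewrite mxE => ->; rewrite mulr0. Qed.

Lemma dominates_proj x : nonneg x -> x != 0 -> dominates (proj_image x) x.
Proof. by move=> x0 xn0; rewrite -{2}(proj_imageK x0 xn0); exact: dominatesZ. Qed.

(** If [y] vanishes wherever [x] does, a small multiple of [y] can be split off from
[x], which exhibits [x] as a proper convex combination involving [y]. *)
Lemma vertices_support x :
  vertices P x <-> P x /\ forall y, P y -> dominates x y -> y = x.
Proof.
split=> [[Px ext]|[Px sup]]; split=> //; last first.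
  move=> y z t Py Pz /andP[t0 t1] xE; have [[y0 _] _] := Py; have [[z0 _] _] := Pz.
  have t1' : 0 < 1 - t by lra.
  have H i j : x i j = 0 -> y i j = 0 /\ z i j = 0.
    rewrite xE !mxE => /eqP.
    rewrite paddr_eq0; [|exact: mulr_ge0 (ltW t0) _|exact: mulr_ge0 (ltW t1') _].
    by rewrite !mulf_eq0 (gt_eqF t0) (gt_eqF t1') /= => /andP[/eqP ? /eqP ?].
  have -> : y = x by apply: sup => // i j /H[].
  by apply/esym; apply: sup => // i j /H[].
move=> y Py xy; have [[x0 x1] Dx] := Px; have [[y0 y1] Dy] := Py.
(* y vanishes wherever x does, so t *: y stays below x for small t. *)
have near_t : \forall t \near (0 : R)^'+, forall i j, t * y i j <= x i j.
  apply: filter_forall => i; apply: filter_forall => j.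
  have [xij|xij] := eqVneq (x i j) 0.
    by apply: nearW => t; rewrite xij xy // mulr0.
  have xp : 0 < x i j by rewrite lt_neqAle eq_sym xij x0.
  have yp : 0 < y i j + 1 by rewrite ltr_wpDl.
  have g0 : \forall t \near (0 : R)^'+, 0 < t by exact: nbhs_right_gt.
  have l1 : \forall t \near (0 : R)^'+, t < x i j / (y i j + 1).
    by apply: nbhs_right_lt; rewrite divr_gt0.
  apply: filterS2 g0 l1 => t t0; rewrite ltr_pdivlMr //; lra.
have g0 : \forall t \near (0 : R)^'+, 0 < t by exact: nbhs_right_gt.
have l1 : \forall t \near (0 : R)^'+, t < 1 by exact: nbhs_right_lt.
have [t [Ht [t0 t1]]] := filter_ex (filterI near_t (filterI g0 l1)).
have t1' : 0 < 1 - t by lra.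
pose z := (1 - t)^-1 *: (x - t *: y).
have zE : (1 - t) *: z = x - t *: y by rewrite scalerA divff ?scale1r // gt_eqF.
have Pz : P z.
  split; last by apply: D_scale; rewrite addrC -scaleNr; exact: D_linear.
  split=> [i j|].
    by rewrite !mxE; apply: mulr_ge0; rewrite ?invr_ge0 ?subr_ge0 ?Ht // ltW.
  rewrite coord_sumZ coord_sumD -scaleNr coord_sumZ x1 y1 mulr1 mulVf //.
  by rewrite gt_eqF.
have yz : y = z by apply: (ext y z t) => //; [rewrite t0|rewrite zE addrC subrK].
have : x = t *: y + (1 - t) *: z by rewrite zE addrC subrK.
by rewrite -yz -scalerDl addrC subrK scale1r.
Qed.

(** The face of the cone spanned by a vertex is a ray. *)
Lemma vertex_ray x u : vertices P x -> nonneg u -> D u -> u != 0 ->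
  dominates x u -> proj_image u = x.
Proof.
move=> /vertices_support[Px sup] u0 Du un0 xu; apply: sup.
  exact: proj_image_polytope.
by apply: dominates_trans xu _; exact: dominatesZ.
Qed.

(** If [x] is not on the ray of a vertex, some other [u] in the polytope has all its
zeros; subtracting the largest multiple of [u] that keeps [x] non-negative gives a
non-zero element with fewer non-zero coordinates. *)
Lemma ex_dominated_vertex x : nonneg x -> D x -> x != 0 ->
  exists2 y, vertices P y & dominates x y.
Proof.
have [k] := ubnP #|[pred ij : 'I_n * 'I_m | x ij.1 ij.2 != 0]|.
elim: k x => // k IHk x; rewrite ltnS => xk x0 Dx xn0.
have [p [Pp xp px]] : exists p, [/\ P p, dominates x p & dominates p x].
  exists (proj_image x); split; [exact: proj_image_polytope|exact: dominatesZ|].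
  exact: dominates_proj.
have [vp|/vertices_support nvp] := pselect (vertices P p).
  by exists p.
have [u [Pu pu up]] : exists u, [/\ P u, dominates p u & u <> p].
  apply: contrapT => H; apply: nvp; split=> // y Py py.
  by apply: contrapT => yp; apply: H; exists y.
have [[u0 u1] Du] := Pu; have [[p0 p1] Dp] := Pp.
have [[i0 j0] /= uij] : exists ij : 'I_n * 'I_m, u ij.1 ij.2 != 0.
  apply: contrapT => H; have := nonneg_sum1_neq0 (conj u0 u1); case/negP.
  apply/eqP/matrixP => i j; rewrite mxE; apply/eqP; apply: contraT => uij.
  by case: H; exists (i, j).
case: (@Order.TotalTheory.arg_minP _ R _ (i0, j0)
  (fun ij : 'I_n * 'I_m => u ij.1 ij.2 != 0)
  (fun ij => p ij.1 ij.2 / u ij.1 ij.2) uij) => -[i1 j1] /= uij1 Hmin.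
have [l lE] : exists l, l = p i1 j1 / u i1 j1 by eexists.
rewrite -lE in Hmin.
pose w := p - l *: u.
have w0 : nonneg w.
  move=> i j; rewrite !mxE subr_ge0; have [->|uij'] := eqVneq (u i j) 0.
    by rewrite mulr0.
  rewrite -ler_pdivlMr; first exact: (Hmin (i, j)).
  by rewrite lt_neqAle eq_sym uij' u0.
have wn0 : w != 0.
  apply/eqP => /eqP; rewrite subr_eq0 => /eqP pE; apply: up.
  have := p1; rewrite pE coord_sumZ u1 mulr1 => l1.
  by rewrite l1 scale1r.
have Dw : D w by rewrite /w addrC -scaleNr; exact: D_linear.
have pw : dominates p w by move=> i j pij; rewrite !mxE pij (pu _ _ pij) mulr0 subr0.
have xw : dominates x w := dominates_trans xp pw.
have [||||y vy wy] := IHk w => //; last first.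
  by exists y => //; exact: dominates_trans wy.
apply: leq_trans xk; apply: proper_card; apply/properP; split.
  apply/fintype.subsetP => ij; rewrite !inE; apply: contra => /eqP xij.
  by rewrite xw.
exists (i1, j1); rewrite !inE /=.
  by apply: contra uij1 => /eqP xij; rewrite (pu _ _ (xp _ _ xij)).
by rewrite negbK !mxE lE divfK // subrr.
Qed.

End Polytope.

(** * Lifting quadrilateral vectors *)

Section Conversion.
Context (R : realType) (n : nat) (T : triangulation n).
Implicit Types (v w : 'M[R]_(n, 4 + 3)) (q : 'M[R]_(n, 3)).

Lemma quad_coord_linear a (p q : 'M[R]_(n, 3)) i b c :
  quad_coord (a *: p + q) i b c = a * quad_coord p i b c + quad_coord q i b c.
Proof.
by rewrite /quad_coord mulr_sumr -big_split; apply: eq_bigr => k _; rewrite !mxE.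
Qed.

Lemma quad_coord0 i b c : quad_coord (0 : 'M[R]_(n, 3)) i b c = 0.
Proof. by rewrite /quad_coord big1 // => k _; rewrite mxE. Qed.

Lemma tri_coord_linear a v w i b :
  tri_coord (a *: v + w) i b = a * tri_coord v i b + tri_coord w i b.
Proof. by rewrite /tri_coord !mxE. Qed.

Lemma quad_proj_linear a v w : quad_proj (a *: v + w) = a *: quad_proj v + quad_proj w.
Proof. exact: linearP. Qed.

Lemma quad_projZ a v : quad_proj (a *: v) = a *: quad_proj v.
Proof. exact: linearZ. Qed.

Lemma quad_proj0 : quad_proj (0 : 'M[R]_(n, 4 + 3)) = 0.
Proof. exact: linear0. Qed.

Lemma standard_matching0 : standard_matching T (0 : 'M[R]_(n, 4 + 3)).
Proof.
by move=> i f j s c _ _; rewrite quad_proj0 !quad_coord0 /tri_coord !mxE.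
Qed.

Lemma standard_matching_linear a v w : standard_matching T v ->
  standard_matching T w -> standard_matching T (a *: v + w).
Proof.
move=> mv mw i f j s c g cf; have := mv _ _ _ _ _ g cf; have := mw _ _ _ _ _ g cf.
rewrite quad_proj_linear !quad_coord_linear !tri_coord_linear => h1 h2.
by rewrite addrACA -mulrDr h1 h2 mulrDr addrACA.
Qed.

Lemma quad_matching0 : quad_matching T (0 : 'M[R]_(n, 3)).
Proof. by move=> c _; rewrite !big1 // => x _; exact: quad_coord0. Qed.

Lemma quad_matching_linear a (p q : 'M[R]_(n, 3)) : quad_matching T p ->
  quad_matching T q -> quad_matching T (a *: p + q).
Proof.
move=> mp mq c uc.
under eq_bigr do rewrite quad_coord_linear.
under [RHS]eq_bigr do rewrite quad_coord_linear.
by rewrite !big_split /= -!mulr_sumr (mp c uc) (mq c uc).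
Qed.

(** Summing the differences around the cycle telescopes, because it returns to its
starting point. *)
Lemma cycle_telescope (S : Type) (e : rel S) (A B t : S -> R) (c : seq S) :
  (forall x y, e x y -> A x - B y = t y - t x) -> path.cycle e c ->
  \sum_(x <- c) A x = \sum_(x <- c) B x.
Proof.
move=> H; case: c => [|x c]; first by rewrite !big_nil.
rewrite /path.cycle => pc.
have tele p : forall y, path e y p ->
    \sum_(z <- belast y p) A z - \sum_(z <- p) B z = t (last y p) - t y.
  elim: p => [|z p IH] y /=; first by rewrite !big_nil !subrr.
  by move=> /andP[/H yz /IH]; rewrite !big_cons; lra.
have := tele _ _ pc; rewrite belast_rcons last_rcons subrr -cats1 big_cat big_seq1 /=.
by rewrite !big_cons; lra.
Qed.

(** Going around an edge, the triangle coordinates at its lower end cancel. *)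
Lemma quad_proj_matching v : standard_matching T v -> quad_matching T (quad_proj v).
Proof.
move=> mv c /andP[cc _]; apply/esym.
apply: (cycle_telescope (t := fun x => tri_coord v x.1 (tour_lower x))) cc => x y.
rewrite /tour_step; case g : (glue _ _ _) => [[j s]|//] /and4P[/eqP -> /eqP -> _ /eqP ->].
have lf : tour_lower x != tour_leave x.
  by rewrite /tour_lower /tour_leave (inj_eq perm_inj) -val_eqE /= !inordK.
have := mv _ _ _ _ _ g lf.
rewrite [quad_coord _ _ (tour_leave x) _]quad_coordC.
by rewrite [quad_coord _ _ (s (tour_leave x)) _]quad_coordC; lra.
Qed.

(** The dual graph of the vertex links; its components are the vertices of the
triangulation. *)
Definition corner_adj : rel ('I_n * 'I_4) := fun a b =>
  [exists f, if glue T a.1 f is Some (j, s) then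
     [&& a.2 != f, b.1 == j & b.2 == s a.2] else false].

Lemma corner_adjP a b : reflect
  (exists f s, [/\ glue T a.1 f = Some (b.1, s), a.2 != f & b.2 = s a.2])
  (corner_adj a b).
Proof.
apply: (iffP existsP) => [[f]|[f [s [g af bs]]]]; last first.
  by exists f; rewrite g af bs !eqxx.
case g : (glue _ _ _) => [[j s]|//] /and3P[af /eqP bj /eqP bs].
by exists f, s; rewrite g bj.
Qed.

Lemma corner_adj_sym : symmetric corner_adj.
Proof.
suff H a b : corner_adj a b -> corner_adj b a by move=> a b; apply/idP/idP; exact: H.
case/corner_adjP => f [s [g af bs]]; apply/corner_adjP.
exists (s f), (s^-1)%g; split; first exact: glue_sym g.
  by rewrite bs (inj_eq perm_inj).
by rewrite bs permK.
Qed.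

Local Notation linked := (connect corner_adj).

Lemma linked_sym : symmetric linked.
Proof. by move=> a b; apply: sym_connect_sym; exact: corner_adj_sym. Qed.

Lemma tri_diff_linked v w a b : standard_matching T v -> standard_matching T w ->
  quad_proj v = quad_proj w -> linked a b ->
  tri_coord v a.1 a.2 - tri_coord w a.1 a.2 = tri_coord v b.1 b.2 - tri_coord w b.1 b.2.
Proof.
move=> mv mw vw /connectP[p]; elim: p a => [|c p IH] a /=; first by move=> _ ->.
move=> /andP[/corner_adjP[f [s [g af cs]]] pc] bE; rewrite -(IH c pc bE).
have := mv _ _ _ _ _ g af; have := mw _ _ _ _ _ g af.
by rewrite vw cs; lra.
Qed.

(** For a non-negative vector: no positive multiple of a vertex link can be subtracted
without leaving the non-negative cone. *)
Definition canonical v :=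
  forall a, exists2 b, linked a b & tri_coord v b.1 b.2 = 0.

Lemma tri_quad_eq v w : (forall i c, tri_coord v i c = tri_coord w i c) ->
  quad_proj v = quad_proj w -> v = w.
Proof.
move=> tvw qvw; rewrite -[v]hsubmxK -[w]hsubmxK; congr row_mx => //.
by apply/matrixP => i c; exact: tvw.
Qed.

Lemma tri_ge0 v i c : nonneg v -> 0 <= tri_coord v i c.
Proof. by move=> v0; rewrite /tri_coord mxE; exact: v0. Qed.

(** The difference of the triangle coordinates is constant on each link; at a zero of
[v] it is not positive and at a zero of [w] it is not negative. *)
Lemma canonical_unique v w : nonneg v -> nonneg w -> standard_matching T v ->
  standard_matching T w -> canonical v -> canonical w -> quad_proj v = quad_proj w ->
  v = w.
Proof.
move=> v0 w0 mv mw cv cw vw; apply: tri_quad_eq => // i c.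
have [b1 l1 z1] := cv (i, c); have [b2 l2 z2] := cw (i, c).
have /= := tri_diff_linked mv mw vw l1; have /= := tri_diff_linked mv mw vw l2.
have := tri_ge0 b2.1 b2.2 v0; have := tri_ge0 b1.1 b1.2 w0.
by rewrite z1 z2; lra.
Qed.

Lemma canonicalZ a v : canonical v -> canonical (a *: v).
Proof.
move=> cv b; have [b' l z] := cv b; exists b' => //.
by move: z; rewrite /tri_coord !mxE => ->; rewrite mulr0.
Qed.

Lemma canonical_dominates v w : canonical v -> dominates v w -> canonical w.
Proof.
move=> cv vw b; have [b' l z] := cv b; exists b' => //.
by move: z; rewrite /tri_coord !mxE => /vw.
Qed.

Definition vertex_link a : 'M[R]_(n, 4 + 3) :=
  row_mx (\matrix_(i, c) (linked a (i, c))%:R) 0.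

Lemma tri_vertex_link a i c : tri_coord (vertex_link a) i c = (linked a (i, c))%:R.
Proof. by rewrite /tri_coord row_mxKl mxE. Qed.

Lemma quad_vertex_link a : quad_proj (vertex_link a) = 0.
Proof. exact: row_mxKr. Qed.

Lemma vertex_link_ge0 a : nonneg (vertex_link a).
Proof.
move=> i k; rewrite /vertex_link; case: (split_ordP k) => c ->.
  by rewrite row_mxEl mxE ler0n.
by rewrite row_mxEr mxE.
Qed.

Lemma vertex_link_matching a : standard_matching T (vertex_link a).
Proof.
move=> i f j s c g cf; rewrite quad_vertex_link !quad_coord0 !addr0 !tri_vertex_link.
congr (_%:R); have adj : corner_adj (i, c) (j, s c) by apply/corner_adjP; exists f, s.
congr nat_of_bool; apply/idP/idP => ac; apply: connect_trans ac _.
  exact: connect1.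
by rewrite linked_sym connect1.
Qed.

(** A vertex of the polytope that is not canonical dominates a vertex link, hence is
proportional to it and has zero projection. *)
Lemma vertex_canonical v : vertices (standard_solution_space T) v ->
  quad_proj v != 0 -> canonical v.
Proof.
move=> vv qv a; apply: contrapT => na.
have tv b : linked a b -> tri_coord v b.1 b.2 != 0.
  by move=> ab; apply/eqP => z; apply: na; exists b.
have ln0 : vertex_link a != 0.
  apply/eqP => l0; have := tri_vertex_link a a.1 a.2.
  by rewrite l0 /tri_coord !mxE -surjective_pairing connect0; move/eqP; rewrite eq_sym oner_eq0.
have dl : dominates v (vertex_link a).
  move=> i k; rewrite /vertex_link; case: (split_ordP k) => c -> z; last by rewrite row_mxEr mxE.
  rewrite row_mxEl mxE; case: (boolP (linked a (i, c))) => // /tv /eqP[].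
  by rewrite /tri_coord mxE.
have := @vertex_ray _ _ _ (standard_matching T) standard_matching0 standard_matching_linear
  v (vertex_link a) vv (vertex_link_ge0 a) (@vertex_link_matching a) ln0 dl.
move=> vE; move/negP: qv; apply.
by rewrite -vE quad_projZ quad_vertex_link scaler0.
Qed.

(** Subtracting from a solution of the crossing equations its minimum around each
vertex makes it non-negative with a zero there. *)
Lemma ex_canonical_lift q : compact_3manifold R (realization R T) -> nonneg q ->
  quad_matching T q -> exists v, [/\ nonneg v, standard_matching T v, canonical v
    & quad_proj v = q].
Proof.
move=> mfd q0 qm; have [t tP] := corner_potential qm mfd.
pose t' (a : 'I_n * 'I_4) := t a.1 a.2.
pose least a := [arg min_(b < a | linked a b) t' b]%O.
have leastP a : linked a (least a) /\ forall b, linked a b -> t' (least a) <= t' b.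
  by rewrite /least; case: Order.TotalTheory.arg_minP => [|b ab Hb]; [exact: connect0|].
have least_linked a b : linked a b -> t' (least a) = t' (least b).
  move=> ab; have [la ma] := leastP a; have [lb mb] := leastP b.
  apply/eqP; rewrite eq_le ma ?mb //.
    by rewrite linked_sym in ab; exact: connect_trans la.
  exact: connect_trans lb.
pose v := row_mx (\matrix_(i < n, c < 4) (t i c - t' (least (i, c)))) q.
have vt i c : tri_coord v i c = t i c - t' (least (i, c)).
  by rewrite /tri_coord row_mxKl mxE.
have vq : quad_proj v = q by exact: row_mxKr.
exists v; split=> //.
- move=> i k; rewrite /v; case: (split_ordP k) => c ->; last by rewrite row_mxEr.
  rewrite row_mxEl mxE subr_ge0; have [_ least_min] := leastP (i, c).
  exact: (least_min (i, c) (connect0 _ _)).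
- move=> i f j s c g cf; rewrite vq !vt (tP _ _ _ _ _ g cf) /crossing g.
  have adj : corner_adj (i, c) (j, s c) by apply/corner_adjP; exists f, s.
  by rewrite (least_linked _ _ (connect1 adj)); lra.
- move=> a; have [la _] := leastP a; exists (least a) => //.
  by rewrite vt -surjective_pairing -/(t' _) -(least_linked _ _ la) subrr.
Qed.

Lemma quad_constraintsZ a q : quad_constraints q -> quad_constraints (a *: q).
Proof.
move=> qc i k l; rewrite !mxE !mulf_eq0 !negb_or => /andP[_ hk] /andP[_ hl].
exact: qc hk hl.
Qed.

(** Whatever the canonical lift of [q] dominates is again canonical, and projects to
a multiple of [q] because [q] is a vertex; by uniqueness it is a multiple of the
lift. *)
Lemma quad_vertex_lift q : compact_3manifold R (realization R T) ->
  quad_solution_set T q ->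
  exists2 v, standard_solution_set T v & proj_image (quad_proj v) = q.
Proof.
move=> mfd [vq qc]; have [[qs qm] _] := vq; have [q0 q1] := qs.
have qn0 := nonneg_sum1_neq0 qs.
have [w [w0 mw cw wq]] := ex_canonical_lift mfd q0 qm.
have wn0 : w != 0 by apply: contra_neq qn0 => w0'; rewrite -wq w0' quad_proj0.
have sw := coord_sum_gt0 w0 wn0.
exists (proj_image w); last first.
  rewrite quad_projZ wq proj_imageZ ?proj_image_id //.
  by rewrite invr_neq0 // gt_eqF.
split; last by rewrite quad_projZ wq; exact: quad_constraintsZ.
apply/vertices_support; [exact: standard_matching0|exact: standard_matching_linear|].
split.
  exact: (proj_image_polytope standard_matching0 standard_matching_linear).
move=> u [us mu] wu; have [u0 u1] := us.
have wu' : dominates w u by apply: dominates_trans wu; exact: dominatesZ.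
have cu := canonical_dominates cw wu'.
have qu0 : nonneg (quad_proj u) by move=> i j; rewrite mxE; exact: u0.
have [qun|qun] := eqVneq (quad_proj u) 0.
  have u00 : u = 0.
    apply: canonical_unique => //.
    - by move=> i j; rewrite mxE.
    - exact: standard_matching0.
    - by move=> a; exists a; rewrite ?connect0 // /tri_coord !mxE.
    - by rewrite qun quad_proj0.
  by have := nonneg_sum1_neq0 us; rewrite u00 eqxx.
have qE : proj_image (quad_proj u) = q.
  apply: (@vertex_ray _ _ _ (quad_matching T) quad_matching0 quad_matching_linear) => //.
    exact: quad_proj_matching.
  by move=> i j; rewrite -wq !mxE; exact: wu'.
have uE : u = coord_sum (quad_proj u) *: w.
  apply: canonical_unique => //.
  - by move=> i j; rewrite mxE mulr_ge0 // ltW // coord_sum_gt0.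
  - by rewrite -[_ *: _]addr0; apply: standard_matching_linear => //; exact: standard_matching0.
  - exact: canonicalZ.
  - by rewrite quad_projZ wq -qE proj_imageK.
by rewrite -[LHS]proj_image_id // uE proj_imageZ // gt_eqF // coord_sum_gt0.
Qed.

Lemma standard_proj_inj v w : standard_solution_set T v -> standard_solution_set T w ->
  quad_proj v != 0 -> quad_proj w != 0 ->
  proj_image (quad_proj v) = proj_image (quad_proj w) -> v = w.
Proof.
move=> [vv _] [vw _] qv qw E; have [[[v0 v1] mv] _] := vv; have [[[w0 w1] mw] _] := vw.
have qv0 : nonneg (quad_proj v) by move=> i j; rewrite mxE; exact: v0.
have qw0 : nonneg (quad_proj w) by move=> i j; rewrite mxE; exact: w0.
have sv := coord_sum_gt0 qv0 qv; have sw := coord_sum_gt0 qw0 qw.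
have vE : v = (coord_sum (quad_proj v) / coord_sum (quad_proj w)) *: w.
  apply: canonical_unique => //.
  - by move=> i j; rewrite mxE mulr_ge0 // ltW // divr_gt0.
  - by rewrite -[_ *: _]addr0; apply: standard_matching_linear => //; exact: standard_matching0.
  - exact: vertex_canonical.
  - by apply: canonicalZ; exact: vertex_canonical.
  - by rewrite quad_projZ -scalerA -/(proj_image (quad_proj w)) -E proj_imageK.
rewrite -[LHS]proj_image_id // -[RHS]proj_image_id // {1}vE proj_imageZ //.
by rewrite gt_eqF // divr_gt0.
Qed.

Lemma standard_proj_nonneg v : standard_solution_set T v ->
  [/\ nonneg (quad_proj v), quad_matching T (quad_proj v) & quad_constraints (quad_proj v)].
Proof.
move=> [[[[v0 _] mv] _] qc]; split=> //; last exact: quad_proj_matching.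
by move=> i j; rewrite mxE; exact: v0.
Qed.

(** The projection dominates some quadrilateral vertex, which is itself the
projection of a standard vertex; minimality forces the two standard vertices to
coincide. *)
Lemma minimal_proj_vertex v : compact_3manifold R (realization R T) ->
  standard_solution_set T v -> quad_proj v != 0 ->
  (forall w, standard_solution_set T w -> quad_proj w != 0 -> w <> v ->
     ~ dominates (quad_proj v) (quad_proj w)) ->
  quad_solution_set T (proj_image (quad_proj v)).
Proof.
move=> mfd sv qv minv; have [q0 qm qc] := standard_proj_nonneg sv.
have [y vy qy] := ex_dominated_vertex quad_matching0 quad_matching_linear q0 qm qv.
have ys : quad_solution_set T y.
  split=> // i k l yk yl; apply: (qc i).
    by apply: contraNneq yk => /qy ->.
  by apply: contraNneq yl => /qy ->.
have [w sw wy] := quad_vertex_lift mfd ys.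
have [[ysum _] _] := vy; have yn0 := nonneg_sum1_neq0 ysum.
have qw : quad_proj w != 0.
  by apply: contra_neq yn0 => w0; rewrite -wy w0 /proj_image scaler0.
have [wv|wv] := pselect (w = v); first by rewrite -wv wy.
case: (minv w sw qw wv); apply: dominates_trans qy _; rewrite -wy.
by apply: dominates_proj => //; have [] := standard_proj_nonneg sw.
Qed.

Lemma vertex_proj_minimal v w : standard_solution_set T v -> standard_solution_set T w ->
  quad_proj v != 0 -> quad_proj w != 0 ->
  quad_solution_set T (proj_image (quad_proj v)) ->
  dominates (quad_proj v) (quad_proj w) -> w = v.
Proof.
move=> sv sw qv qw [vq _] vw; apply: standard_proj_inj => //.
have [q0 qm _] := standard_proj_nonneg sw; have [p0 _ _] := standard_proj_nonneg sv.
apply: (@vertex_ray _ _ _ (quad_matching T) quad_matching0 quad_matching_linear) => //.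
by apply: dominates_trans vw; exact: dominates_proj.
Qed.

End Conversion.

(** * The conversion algorithm *)

Lemma cost_bind (A B : Type) (m : timed A) (f : A -> timed B) :
  cost (bind m f) = (cost m + cost (f (value m)))%N.
Proof. by []. Qed.

Section TimedLoops.
Context (A B : Type).

Lemma value_mapT (f : A -> timed B) s : value (mapT f s) = map (fun a => value (f a)) s.
Proof. by elim: s => //= a s <-. Qed.

Lemma value_filterT (p : A -> timed bool) s :
  value (filterT p s) = [seq a <- s | value (p a)].
Proof. by elim: s => //= a s <-. Qed.

Lemma value_hasT (p : A -> timed bool) s :
  value (hasT p s) = has (fun a => value (p a)) s.
Proof. by elim: s => //= a s <-; rewrite /bind /=; case: (value (p a)). Qed.

(** The main loop of the algorithm filters and maps. *)
Lemma value_collect (p : A -> timed bool) (f : A -> timed B) L s :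
  value (foldT (fun L a => bind (p a) (fun d => if d then ret L else
           bind (f a) (fun b => ret (rcons L b)))) L s) =
  L ++ [seq value (f a) | a <- s & ~~ value (p a)].
Proof.
elim: s L => [|a s IH] L /=; first by rewrite cats0.
by rewrite IH; case: (value (p a)) => //=; rewrite cat_rcons.
Qed.

Lemma cost_mapT (f : A -> timed B) k s : (forall a, cost (f a) <= k)%N ->
  (cost (mapT f s) <= size s * k.+1)%N.
Proof.
by move=> fk; elim: s => //= a s IH; have := fk a; rewrite /bind /cost /= in IH *; lia.
Qed.

Lemma cost_filterT (p : A -> timed bool) k s : (forall a, cost (p a) <= k)%N ->
  (cost (filterT p s) <= size s * k.+1)%N.
Proof.
by move=> pk; elim: s => //= a s IH; have := pk a; rewrite /bind /cost /= in IH *; lia.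
Qed.

Lemma cost_hasT (p : A -> timed bool) k s : (forall a, cost (p a) <= k)%N ->
  (cost (hasT p s) <= size s * k.+1)%N.
Proof.
move=> pk; elim: s => //= a s IH; have := pk a; rewrite /bind /=.
by case: (value (p a)); rewrite /cost /= in IH *; lia.
Qed.

Lemma cost_allT (p : A -> timed bool) k s : (forall a, cost (p a) <= k)%N ->
  (cost (allT p s) <= size s * k.+1)%N.
Proof.
move=> pk; elim: s => //= a s IH; have := pk a; rewrite /bind /=.
by case: (value (p a)); rewrite /cost /= in IH *; lia.
Qed.

Lemma cost_foldT (f : B -> A -> timed B) k b s : (forall b a, cost (f b a) <= k)%N ->
  (cost (foldT f b s) <= size s * k.+1)%N.
Proof.
move=> fk; elim: s b => //= a s IH b; have := fk b a; have := IH (value (f b a)).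
by rewrite /bind /cost /=; lia.
Qed.

End TimedLoops.

Section Algorithm.
Context (R : realType) (n : nat).
Implicit Types (vs : seq 'M[R]_(n, 4 + 3)) (qs : seq 'M[R]_(n, 3)).

Lemma cost_build_vectorT m (F : 'I_n -> 'I_m -> timed R) k :
  (forall i j, cost (F i j) <= k)%N -> (cost (build_vectorT F) <= n * (m * k.+1))%N.
Proof.
move=> Fk; rewrite /build_vectorT /cost /=.
apply: (@leq_trans (\sum_(i < n) \sum_(j < m) k.+1)%N).
  by apply: leq_sum => i _; apply: leq_sum => j _; rewrite ltnS; exact: Fk.
by rewrite !sum_nat_const !card_ord.
Qed.

Lemma size_positions m : size (enum {: 'I_n * 'I_m}) = (n * m)%N.
Proof. by rewrite -cardE card_prod !card_ord. Qed.

Lemma cost_quad_projT (v : 'M[R]_(n, 4 + 3)) : (cost (quad_projT v) <= 3 * n)%N.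
Proof.
have := @cost_build_vectorT 3 (fun i k => ret (v i (rshift 4 k))) 0
  (fun _ _ => leqnn _).
by rewrite /quad_projT; lia.
Qed.

Lemma cost_nonzeroT (x : 'M[R]_(n, 3)) : (cost (nonzeroT x) <= 6 * n)%N.
Proof.
have := @cost_allT ('I_n * 'I_3)%type (fun c => is0T (x c.1 c.2)) 1
  (enum {: 'I_n * 'I_3}) (fun=> leqnn _).
by rewrite size_positions /nonzeroT /bind /cost /=; lia.
Qed.

Lemma cost_dominatesT (x y : 'M[R]_(n, 3)) : (cost (dominatesT x y) <= 9 * n)%N.
Proof.
have := @cost_allT ('I_n * 'I_3)%type (fun c => let* z := is0T (x c.1 c.2) in
  if z then is0T (y c.1 c.2) else ret true) 2 (enum {: 'I_n * 'I_3}).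
rewrite size_positions -/(dominatesT x y) => H.
apply: leq_trans (H _) _; last by lia.
by move=> c; rewrite /bind /cost /=; case: (_ == 0).
Qed.

Lemma cost_proj_imageT (x : 'M[R]_(n, 3)) : (cost (proj_imageT x) <= 12 * n)%N.
Proof.
rewrite /proj_imageT /bind; set s := foldT _ _ _.
have h1 : (cost s <= 6 * n)%N.
  have := @cost_foldT ('I_n * 'I_3)%type R (fun a c => addT a (x c.1 c.2)) 1 0
    (enum {: 'I_n * 'I_3}) (fun _ _ => leqnn _).
  by rewrite size_positions -/s; lia.
have h2 : (cost (build_vectorT (fun i j => divT (x i j) (value s))) <= n * (3 * 2))%N.
  exact: cost_build_vectorT.
by move: h1 h2; rewrite /cost /=; lia.
Qed.

Lemma cost_dominates_anotherT qs i :
  (cost (dominates_anotherT qs i) <= size qs * (9 * n).+1)%N.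
Proof.
rewrite -(size_iota 0 (size qs)); apply: cost_hasT => j.
by case: eqP => // _; exact: cost_dominatesT.
Qed.

Definition nonzero_projections vs := [seq p <- map (@quad_proj R n) vs | p != 0].

Lemma value_nonzero_projectionsT vs :
  value (nonzero_projectionsT vs) = nonzero_projections vs.
Proof.
rewrite /nonzero_projectionsT /bind /= value_filterT value_mapT.
rewrite (eq_map (@value_quad_projT R n)); apply: eq_filter => p.
exact: value_nonzeroT.
Qed.

Lemma cost_nonzero_projectionsT vs :
  (cost (nonzero_projectionsT vs) <= size vs * (9 * n + 2))%N.
Proof.
rewrite /nonzero_projectionsT /bind.
have h1 := cost_mapT vs cost_quad_projT.
have h2 := cost_filterT (value (mapT (@quad_projT R n) vs)) cost_nonzeroT.
by move: h1 h2; rewrite value_mapT size_map /cost /=; lia.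
Qed.

Definition dominates_another qs i :=
  has (fun j => (j != i) && value (dominatesT qs`_i qs`_j)) (iota 0 (size qs)).

Lemma value_dominates_anotherT qs i :
  value (dominates_anotherT qs i) = dominates_another qs i.
Proof.
by rewrite /dominates_anotherT value_hasT; apply: eq_has => j; case: (j == i).
Qed.

Lemma value_standard_to_quadT vs (qs := nonzero_projections vs) :
  value (standard_to_quadT vs) =
  [seq proj_image qs`_i | i <- iota 0 (size qs) & ~~ dominates_another qs i].
Proof.
rewrite /standard_to_quadT
  -[LHS]/(value (foldT _ _ (iota 0 (size (value (nonzero_projectionsT vs)))))).
rewrite value_nonzero_projectionsT -/qs.
rewrite (@value_collect _ _ (dominates_anotherT qs) (fun i => proj_imageT qs`_i)) /=.
under eq_filter do rewrite value_dominates_anotherT.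
by apply: eq_map => i; exact: value_proj_imageT.
Qed.

(** Each of the at most k iterations performs at most k domination tests of cost 9n
and one normalization of cost 12n; projecting and discarding zero vectors costs 9n
per vector.  With the loop overhead, and as n and k may be assumed positive, 40 is
large enough. *)
Lemma cost_standard_to_quadT vs : (0 < n)%N ->
  (cost (standard_to_quadT vs) <= 40 * (n * size vs ^ 2))%N.
Proof.
move=> n0; rewrite /standard_to_quadT cost_bind value_nonzero_projectionsT.
set qs := nonzero_projections vs.
have sqs : (size qs <= size vs)%N.
  by rewrite -(size_map (@quad_proj R n) vs) size_filter; exact: count_size.
set f := (X in foldT X).
have h1 := cost_nonzero_projectionsT vs.
have h2 : (cost (foldT f [::] (iota 0 (size qs))) <=
    size (iota 0 (size qs)) * (size qs * (9 * n).+1 + 12 * n).+1)%N.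
  apply: cost_foldT => L i; rewrite /f cost_bind.
  apply: leq_add; first exact: cost_dominates_anotherT.
  by case: ifP => // _; rewrite cost_bind addn0; exact: cost_proj_imageT.
rewrite size_iota in h2.
have h3 : (size qs * (size qs * (9 * n).+1 + 12 * n).+1 <=
    size vs * (size vs * (9 * n).+1 + 12 * n).+1)%N.
  by apply: leq_mul => //; rewrite ltnS leq_add2r leq_mul2r sqs orbT.
apply: leq_trans (leq_add h1 (leq_trans h2 h3)) _.
by case: (size vs) => [|k]; rewrite ?expnS ?expn0; nia.
Qed.

End Algorithm.

Section Correctness.
Context (R : realType) (n : nat) (T : triangulation n).
Hypothesis mfd : compact_3manifold R (realization R T).
Context (vs : seq 'M[R]_(n, 4 + 3)).
Hypothesis vsP : enumerates vs (standard_solution_set T).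

Let us := [seq v <- vs | quad_proj v != 0].
Let qs := nonzero_projections vs.

Lemma nonzero_projectionsE : qs = map (@quad_proj R n) us.
Proof. by rewrite /qs /nonzero_projections filter_map. Qed.

Lemma size_qs : size qs = size us.
Proof. by rewrite nonzero_projectionsE size_map. Qed.

Lemma nth_qs i : (i < size qs)%N -> qs`_i = quad_proj us`_i.
Proof. by move=> iq; rewrite nonzero_projectionsE (nth_map 0) // -size_qs. Qed.

Lemma us_uniq : uniq us.
Proof. by apply: filter_uniq; case: vsP. Qed.

Lemma usP v : v \in us <-> standard_solution_set T v /\ quad_proj v != 0.
Proof.
rewrite mem_filter; case: vsP => _ E.
by split=> [/andP[? /E]|[/E ? ?]] //; apply/andP.
Qed.

Lemma us_nth i : (i < size qs)%N -> standard_solution_set T us`_i /\ quad_proj us`_i != 0.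
Proof. by move=> iq; apply/usP; apply: mem_nth; rewrite -size_qs. Qed.

Lemma us_index v : standard_solution_set T v -> quad_proj v != 0 ->
  exists2 i, (i < size qs)%N & us`_i = v.
Proof.
move=> sv qv; have vu : v \in us by apply/usP.
by exists (index v us); [rewrite size_qs index_mem|exact: nth_index].
Qed.

(** The algorithm compares list positions; since the standard solution set is listed
without repetition, distinct positions are distinct standard vertices. *)
Lemma dominates_anotherP i : (i < size qs)%N ->
  dominates_another qs i <-> exists w, [/\ standard_solution_set T w,
    quad_proj w != 0, w <> us`_i & dominates (quad_proj us`_i) (quad_proj w)].
Proof.
move=> iq; split.
  case/hasP => j; rewrite mem_iota /= => jq /andP[ji /value_dominatesT].
  rewrite !nth_qs // => dj; have [sw qw] := us_nth jq.
  exists us`_j; split=> // /eqP; rewrite nth_uniq -?size_qs ?us_uniq //.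
  by rewrite (negPf ji).
case=> w [sw qw wi dw]; have [j jq jw] := us_index sw qw.
apply/hasP; exists j; first by rewrite mem_iota.
apply/andP; split; first by apply/eqP => ji; apply: wi; rewrite -ji jw.
by apply/value_dominatesT; rewrite !nth_qs // jw.
Qed.

Lemma standard_to_quad_correct :
  enumerates (value (standard_to_quadT vs)) (quad_solution_set T).
Proof.
rewrite value_standard_to_quadT -/qs; split.
  rewrite map_inj_in_uniq; first by apply: filter_uniq; exact: iota_uniq.
  move=> i j; rewrite !mem_filter !mem_iota /= => /andP[_ iq] /andP[_ jq].
  rewrite !nth_qs // => E; have [si qi] := us_nth iq; have [sj qj] := us_nth jq.
  have := standard_proj_inj si sj qi qj E.
  by move/eqP; rewrite nth_uniq -?size_qs ?us_uniq // => /eqP.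
move=> y; split.
  case/mapP => i; rewrite mem_filter mem_iota /= => /andP[/negP ndom iq] ->.
  have [si qi] := us_nth iq; rewrite nth_qs //.
  apply: minimal_proj_vertex => // w sw qw wi dw; apply: ndom.
  by apply/dominates_anotherP => //; exists w.
move=> sy; have [v sv vy] := quad_vertex_lift mfd sy.
have qv : quad_proj v != 0.
  have [[[ysum _] _] _] := sy; apply: contra_neq (nonneg_sum1_neq0 ysum) => v0.
  by rewrite -vy v0 /proj_image scaler0.
have [i iq iv] := us_index sv qv.
apply/mapP; exists i; last by rewrite nth_qs // iv.
rewrite mem_filter mem_iota /= iq andbT; apply/negP => /(dominates_anotherP iq).
case=> w [sw qw]; rewrite iv => wv dw; apply: wv.
by have := vertex_proj_minimal sv sw qv qw; rewrite vy; apply.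
Qed.

End Correctness.

Theorem mainTheorem1 (R : realType) :
  exists C : nat,
    forall (n : nat) (T : triangulation n) (vs : seq 'M[R]_(n, 4 + 3)),
      compact_3manifold R (realization R T) ->
      enumerates vs (standard_solution_set T) ->
      enumerates (value (standard_to_quadT vs)) (quad_solution_set T) /\
      (cost (standard_to_quadT vs) <= C * (n * size vs ^ 2))%N.
Proof.
exists 40 => n T vs mfd vsP; split; first exact: standard_to_quad_correct.
case: n T vs mfd vsP => [|n] T vs mfd vsP; last exact: cost_standard_to_quadT.
suff -> : vs = [::] by [].
case: vs vsP => // v vs [_ /(_ v)]; rewrite mem_head => -[/(_ isT)] [[[[_ +] _] _] _].
rewrite /coord_sum big_ord0 => /eqP; by rewrite eq_sym oner_eq0.
Qed.
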